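(* Let $E\subset\mathbb{R}$ be an open set of finite measure with lower bounded gaps. Let $F\subset\mathbb{R}$ be a measurable set that has the same $3$-deck as $E$, i.e. $N_F=N_E$ almost everywhere on $\mathbb{R}^2$. Then $F$ is a translate of $E$: there exists $a\in\mathbb{R}$ such that $F=E-a$ up to a set of measure zero.
   Context: Measure means Lebesgue measure, denoted $|\cdot|$. The $3$-deck of a measurable set $E\subset\mathbb{R}$ is the function on $\mathbb{R}^2$ given by $N_E(x_1,x_2)=|E\cap(E-x_1)\cap(E-x_2)|$. An open set with lower bounded gaps is an open set of the form $E=\bigcup_{k\in\mathbb{Z}}(\alpha_k,\beta_k)$ with $\alpha_k<\beta_k<\alpha_{k+1}$ for all $k$, whose complement can be written as a union of closed intervals whose length is bounded below by a positive constant, i.e. $\inf_{k}(\alpha_{k+1}-\beta_k)>0$. *)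

(* Defs.v *)
From HB Require Import structures.
From mathcomp Require Import all_boot all_order all_algebra.
From mathcomp Require Import all_classical all_reals all_analysis.

Set Implicit Arguments.
Unset Strict Implicit.
Unset Printing Implicit Defensive.

Import Order.TTheory GRing.Theory Num.Theory.
Import numFieldNormedType.Exports.

Local Open Scope classical_set_scope.
Local Open Scope ring_scope.

(* The bare [measurable] of the library denotes the Borel sets of [R]; the
   Lebesgue measurable sets are those on which [completed_lebesgue_measure]
   is defined, i.e. the Caratheodory measurable sets of the outer measure
   generated by interval length. *)
Definition lebesgue_measurable (R : realType) (A : set R) : Prop :=
  (wlength (@idfun R))^*%mu.-cara.-measurable A.

Definition translate (R : realType) (E : set R) (x : R) : set R :=
  [set y - x | y in E].

Definition three_deck (R : realType) (E : set R) (x : R * R) : \bar R :=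
  completed_lebesgue_measure (E `&` translate E x.1 `&` translate E x.2).

(* [inf] of a set that is not bounded below is [0], but here the values are
   positive, so this is the genuine infimum. *)
Definition open_lower_bounded_gaps (R : realType) (E : set R) : Prop :=
  exists alpha beta : int -> R,
    [/\ forall k, alpha k < beta k,
        forall k, beta k < alpha (k + 1),
        0 < inf [set alpha (k + 1) - beta k | k in [set: int]]
      & E = \bigcup_(k in [set: int]) `]alpha k, beta k[%classic].

(* Main.v *)
(* Write E_h for E `&` (E - h), and similarly F_h. As the gaps of E are longer
   than some delta > 0, a point of E_h with h < delta lies in an interval of E
   longer than h, so N_E(h, y) = |E_h| for 0 < y < h. Transported to F, this makes
   F_h essentially bounded. Now N_E(h, -) is the correlation of E_h with E, so that
   the product of the Fourier transforms of E_h at -c and of E at c is the same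
   for F; and N_E itself determines the product of the Fourier transforms of E at
   p, q and s when p + q + s = 0. The latter product is nonzero near 0 and can be
   cancelled: near 0, the product of the transforms of E_h1, E_h2, E_h3 at p, q, s
   agrees with that of F_h1, F_h2, F_h3. These sets being bounded, the identity
   extends analytically to Laplace transforms, and says that the quotient of the
   Laplace transforms of E_h and F_h does not depend on h and is a character. Its
   value at the integer j is exp(a * j), so E_h is F_h + a, and h tends to 0. *)
Require Import Defs.
From HB Require Import structures.
From mathcomp Require Import all_boot all_order all_algebra.
From mathcomp Require Import all_classical all_reals all_analysis.
From mathcomp Require Import measurable_realfun complex ring lra.
Import Order.TTheory GRing.Theory Num.Theory.
Import numFieldNormedType.Exports.
Local Open Scope classical_set_scope.
Local Open Scope ring_scope.

Set Implicit Arguments.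
Unset Strict Implicit.
Unset Printing Implicit Defensive.

(** * Correlations of sets *)

(** [E] and [F] may be unbounded, so their Fourier transforms need not be analytic, and an identity
    between them near 0 cannot be continued. On bounded pieces all moments are finite, and the
    continuation amounts to comparing moments: three frequencies are scaled by one real variable
    [r], Fourier transforms are expanded at [r = 0], and the exponential series is then summed at
    [r = 1]. Laplace transforms at real arguments are the right target because they are positive on
    non-null bounded sets: quotients can be formed at every argument, whereas a Fourier transform
    may vanish away from 0. Integer arguments suffice, because polynomials in [expR t] approximate
    indicators of rays. The hypothesis holds for almost every pair of shifts only, so just almost
    every [h] can be used, and the argument runs along a sequence of such [h]. The translation is
    computed from one fixed piece and serves all the others, since the quotient is common to
    them. *)

Section product_sigma_finite.
Local Open Scope ereal_scope.
Context d1 d2 (X1 : measurableType d1) (X2 : measurableType d2) (R : realType).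
Variables (m1 : {sigma_finite_measure set X1 -> \bar R})
  (m2 : {sigma_finite_measure set X2 -> \bar R}).

Lemma product_measure_sigma_finite : sigma_finite setT (m1 \x m2).
Proof.
have /sigma_finiteP[F [FT ndF Foo]] := sigma_finiteT m1.
have /sigma_finiteP[G [GT ndG Goo]] := sigma_finiteT m2.
exists (fun n => F n `*` G n) => [|n].
  apply/seteqP; split => // -[x y] _.
  have [i _ Fix] : (\bigcup_n F n) x by rewrite -FT.
  have [j _ Gjy] : (\bigcup_n G n) y by rewrite -GT.
  exists (maxn i j) => //; split => /=.
    by move/subsetPset : (ndF _ _ (leq_maxl i j)); apply.
  by move/subsetPset : (ndG _ _ (leq_maxr i j)); apply.
have [mF Fn] := Foo n; have [mG Gn] := Goo n; split; first exact: measurableX.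
by rewrite product_measure1E// lte_mul_pinfty// ge0_fin_numE.
Qed.

(* The canonical sigma-finite structure of [m1 \x m2] in the library is the one
   of probability measures, hence this explicit packing. *)
Definition sfprod : {sigma_finite_measure set (X1 * X2)%type -> \bar R} :=
  HB.pack (m1 \x m2) (Measure_isSigmaFinite.Build _ _ _ (m1 \x m2) product_measure_sigma_finite).
End product_sigma_finite.

Section lebesgue_translation.
Context {R : realType}.
Local Notation mu := (@lebesgue_measure R).
Local Notation T := (measurableTypeR R).
Local Notation mu2 := (sfprod mu mu).
Implicit Types (E A : set T).
Local Open Scope ereal_scope.

Lemma translateE (E : set R) (x : R) : translate E x = [set t | E (t + x)%R].
Proof.
apply/seteqP; split => [_ [y Ey <-]|t Et] /=; first by rewrite subrK.
by exists (t + x)%R => //; rewrite addrK.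
Qed.

Lemma measurable_shift (a : R) : measurable_fun [set: T] (fun x : T => x + a : T)%R.
Proof.
have h : measurable_fun [set: R] (fun x : R => x + a)%R.
  by apply: measurable_funD.
exact: h.
Qed.

Lemma measurable_translate E (a : R) : measurable E -> measurable (translate E a : set T).
Proof.
move=> mE; rewrite translateE -[X in measurable X]setTI.
exact: measurable_shift.
Qed.

Lemma lebesgue_measure_shift (a : R) (A : set T) : measurable A ->
  pushforward mu (fun x : T => x + a : T)%R A = mu A.
Proof.
move=> mA.
have mf : measurable_fun [set: T] (fun x : T => x + a : T)%R := measurable_shift a.
pose f : {mfun T >-> T} := HB.pack (fun x : T => x + a : T)%R (isMeasurableFun.Build _ _ _ _ _ mf).
rewrite -[LHS]/(pushforward mu f A).
apply/esym/(@lebesgue_measure_unique R (pushforward mu f)) => //= _ [[b c]] _ <-.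
have -> : pushforward mu f `]b, c]%classic = mu `](b - a)%R, (c - a)%R]%classic.
  rewrite /pushforward; congr (mu _); apply/seteqP.
  by split => x /=; rewrite !in_itv/= ltrBlDr lerBrDr.
rewrite !lebesgue_measure_itv/= !lte_fin ltrD2r.
case: ifP => // _; rewrite -!EFinB; congr EFin; ring.
Qed.

Lemma lebesgue_measure_translate A (a : R) : measurable A -> mu (translate A a) = mu A.
Proof. by move=> mA; rewrite translateE -[RHS](lebesgue_measure_shift a mA). Qed.

Lemma ge0_integral_shift (f : T -> \bar R) (a : R) : measurable_fun setT f ->
  (forall x, 0 <= f x) -> \int[mu]_x f (x + a)%R = \int[mu]_x f x.
Proof.
move=> mf f0.
transitivity (\int[pushforward mu (fun x : T => x + a : T)%R]_x f x); last first.
  by apply: eq_measure_integral => [|H A mA _];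
    [exact: measurable_shift|exact: lebesgue_measure_shift].
by rewrite (ge0_integral_pushforward (measurable_shift a)).
Qed.

Lemma indic_translate (E : set R) (x y : R) : \1_(translate E y) x = \1_E (x + y)%R :> R.
Proof. by rewrite !indicE translateE. Qed.

Lemma measurable_indic_comp d (X : measurableType d) (h : X -> T) E : measurable E ->
  measurable_fun setT h -> measurable_fun setT (fun x => (\1_E (h x))%:E : \bar R).
Proof.
move=> mE mh; apply/measurable_EFinP.
by apply: (measurableT_comp _ mh); exact: measurable_indic.
Qed.

Lemma measurable_addT d (X : measurableType d) (f g : X -> T) :
  measurable_fun setT f -> measurable_fun setT g ->
  measurable_fun setT (fun x => (f x + g x)%R : T).
Proof. exact: (@measurable_funD _ _ R setT f g). Qed.

Lemma measurable_subT d (X : measurableType d) (f g : X -> T) :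
  measurable_fun setT f -> measurable_fun setT g ->
  measurable_fun setT (fun x => (f x - g x)%R : T).
Proof. exact: (@measurable_funB _ _ R setT f g). Qed.

(** The difference of a point of [E] and a point of [A] is distributed with the correlation as
    density: substitute [x.2 = y + x.1], then exchange the integrals. For nonnegative [g] Tonelli
    applies without any integrability condition. *)
Lemma integral_correlation A E (g : T -> \bar R) : measurable A -> measurable E ->
  measurable_fun setT g -> (forall x, 0 <= g x) ->
  \int[mu \x mu]_(x in A `*` E) g (x.2 - x.1)%R =
  \int[mu]_y (mu (A `&` translate E y) * g y).
Proof.
move=> mA mE mg g0.
have mdiff : measurable_fun setT (fun x : T * T => (x.2 - x.1)%R : T).
  exact: measurable_subT measurable_snd measurable_fst.
have msum : measurable_fun setT (fun x : T * T => (x.2 + x.1)%R : T).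
  exact: measurable_addT measurable_snd measurable_fst.
pose F (x : T * T) := (\1_A x.1)%:E * ((\1_E x.2)%:E * g (x.2 - x.1)%R).
have mF : measurable_fun setT F.
  apply: emeasurable_funM; first by apply: measurable_indic_comp => //; exact: measurable_fst.
  apply: emeasurable_funM; first by apply: measurable_indic_comp => //; exact: measurable_snd.
  exact: measurableT_comp.
have F0 x : 0 <= F x by rewrite !mule_ge0// lee_fin.
pose G (x : T * T) := (\1_A x.1)%:E * ((\1_E (x.2 + x.1)%R)%:E * g x.2).
have mG : measurable_fun setT G.
  apply: emeasurable_funM; first by apply: measurable_indic_comp => //; exact: measurable_fst.
  apply: emeasurable_funM; first by apply: measurable_indic_comp => //.
  by apply: measurableT_comp => //; exact: measurable_snd.
have G0 x : 0 <= G x by rewrite !mule_ge0// lee_fin.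
transitivity (\int[mu \x mu]_x F x).
  rewrite integral_mkcond; apply: eq_integral => -[x y] _.
  rewrite /F patchE/= !indicE in_setX/=.
  by case: (x \in A); case: (y \in E); rewrite ?mul1e ?mul0e ?mule0.
rewrite fubini_tonelli1//.
transitivity (\int[mu]_x \int[mu]_y G (x, y)).
  apply: eq_integral => x _; rewrite /fubini_F/=.
  rewrite -(@ge0_integral_shift (fun y => F (x, y)) x)//; last first.
    exact: measurableT_comp mF (measurable_pair1 x).
  by apply: eq_integral => y _; rewrite /F /G/= addrK.
rewrite (fubini_tonelli G mG G0).
apply: eq_integral => y _.
under eq_integral do rewrite /G/= muleA -EFinM.
rewrite ge0_integralZr//; last first.
  apply/measurable_EFinP; apply: measurable_funM; first exact: measurable_indic.
  have mE1 : measurable_fun setT (\1_E : T -> R) by exact: measurable_indic.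
  exact: measurableT_comp mE1 (measurableT_comp msum (measurable_pair2 y)).
congr (_ * _).
rewrite -(setIT (A `&` translate E y)) -integral_indic//; last first.
  by apply: measurableI => //; exact: measurable_translate.
by apply: eq_integral => x _; rewrite indicI /= indic_translate addrC.
Qed.

Lemma ge0_integral_shift2 (f : T * T -> \bar R) (a : R) : measurable_fun setT f ->
  (forall x, 0 <= f x) ->
  \int[mu2]_w f (w.1 + a, w.2 + a)%R = \int[mu2]_w f w.
Proof.
move=> mf f0.
have m2 : measurable_fun [set: T * T] (fun w : T * T => ((w.1 + a, w.2 + a)%R : T * T)).
  apply/measurable_fun_pairP; split => /=.
    exact: measurable_addT measurable_fst (measurable_cst _).
  exact: measurable_addT measurable_snd (measurable_cst _).
rewrite [LHS](fubini_tonelli1 _ (measurableT_comp mf m2) (fun x => f0 _)).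
rewrite [RHS](fubini_tonelli1 _ mf f0).
rewrite -(@ge0_integral_shift (fubini_F mu f) a); last 2 first.
- exact: measurable_fun_fubini_tonelli_F.
- by move=> x; exact: integral_ge0.
apply: eq_integral => x _; rewrite /fubini_F/=.
rewrite -(@ge0_integral_shift (fun y => f ((x + a)%R, y)) a)//.
exact: measurableT_comp mf (measurable_pair1 _).
Qed.

Definition deck E (w : T * T) := mu (E `&` translate E w.1 `&` translate E w.2).

(** The analogue for three points of [E]: shifting the first two by the third turns the integrand
    into a function of the two differences, and integrating out the third point leaves the deck as
    density. *)
Lemma integral_deck E (G : T * T -> \bar R) : measurable E ->
  measurable_fun setT G -> (forall x, 0 <= G x) ->
  \int[mu2 \x mu]_(x in (E `*` E) `*` E) G (x.1.1 - x.2, x.1.2 - x.2)%R =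
  \int[mu2]_w (deck E w * G w).
Proof.
move=> mE mG G0.
have m11 : measurable_fun setT (fun x : T * T * T => x.1.1).
  exact: measurableT_comp measurable_fst measurable_fst.
have m12 : measurable_fun setT (fun x : T * T * T => x.1.2).
  exact: measurableT_comp measurable_snd measurable_fst.
pose F (x : T * T * T) := ((\1_E x.1.1)%:E * ((\1_E x.1.2)%:E * (\1_E x.2)%:E)) *
   G (x.1.1 - x.2, x.1.2 - x.2)%R.
have mF : measurable_fun setT F.
  apply: emeasurable_funM.
    apply: emeasurable_funM; first exact: measurable_indic_comp.
    apply: emeasurable_funM; first exact: measurable_indic_comp.
    by apply: measurable_indic_comp => //; exact: measurable_snd.
  apply: measurableT_comp => //.
  by apply/measurable_fun_pairP; split => /=; apply: measurable_subT => //; exact: measurable_snd.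
have F0 x : 0 <= F x by rewrite !mule_ge0// lee_fin.
pose H (x : T * T * T) := ((\1_E (x.1.1 + x.2)%R)%:E * ((\1_E (x.1.2 + x.2)%R)%:E *
   (\1_E x.2)%:E)) * G x.1.
have mE3 : measurable_fun setT (fun x : T * T * T =>
    (\1_E (x.1.1 + x.2)%R)%:E * ((\1_E (x.1.2 + x.2)%R)%:E * (\1_E x.2)%:E) : \bar R).
  apply: emeasurable_funM.
    apply: measurable_indic_comp => //.
    by apply: measurable_addT => //; exact: measurable_snd.
  apply: emeasurable_funM.
    apply: measurable_indic_comp => //.
    by apply: measurable_addT => //; exact: measurable_snd.
  by apply: measurable_indic_comp => //; exact: measurable_snd.
have mH : measurable_fun setT H.
  apply: emeasurable_funM => //.
  by apply: measurableT_comp => //; exact: measurable_fst.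
have H0 x : 0 <= H x by rewrite !mule_ge0// lee_fin.
transitivity (\int[mu2 \x mu]_x F x).
  rewrite integral_mkcond; apply: eq_integral => -[[x y] z] _.
  rewrite /F patchE/= !indicE !in_setX/=.
  by case: (x \in E); case: (y \in E); case: (z \in E); rewrite ?(mul1e, mul0e, mule0).
rewrite (@fubini_tonelli2 _ _ _ _ R mu2 mu F mF F0).
transitivity (\int[mu]_t \int[mu2]_w H (w, t)).
  apply: eq_integral => t _; rewrite /fubini_G/=.
  rewrite -(@ge0_integral_shift2 (fun w => F (w, t)) t)//; last first.
    exact: measurableT_comp mF (measurable_pair2 t).
  by apply: eq_integral => -[x y] _; rewrite /F /H/= !addrK.
rewrite -(@fubini_tonelli _ _ _ _ R mu2 mu H mH H0).
apply: eq_integral => w _.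
rewrite /H/= ge0_integralZr//; last first.
  exact: measurableT_comp mE3 (measurable_pair1 w).
congr (_ * _).
rewrite /deck -(setIT (_ `&` translate E w.2)) -integral_indic//; last first.
  by do 2?apply: measurableI => //; exact: measurable_translate.
apply: eq_integral => t _; rewrite !indicI /= !indic_translate !EFinM.
by rewrite muleA muleC muleA !(addrC t).
Qed.

End lebesgue_translation.

(** * Fourier transforms *)

Section product_integral.
Context d1 d2 (X1 : measurableType d1) (X2 : measurableType d2) {R : realType}.
Variables (m1 : {sigma_finite_measure set X1 -> \bar R})
  (m2 : {sigma_finite_measure set X2 -> \bar R}).

Let Rintegral_prodT (f : X1 -> R) (g : X2 -> R) :
  m1.-integrable setT (EFin \o f) -> m2.-integrable setT (EFin \o g) ->
  ((m1 \x m2)%E.-integrable setT (fun x => (f x.1 * g x.2)%:E)) /\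
  \int[(m1 \x m2)%E]_x (f x.1 * g x.2) =
  (\int[m1]_x f x) * (\int[m2]_x g x).
Proof.
move=> fi gi.
have mf : measurable_fun setT f by apply/measurable_EFinP; exact: measurable_int fi.
have mg : measurable_fun setT g by apply/measurable_EFinP; exact: measurable_int gi.
have mfg : measurable_fun setT (fun x : X1 * X2 => (f x.1 * g x.2)%:E).
  apply/measurable_EFinP; apply: measurable_funM.
    exact: measurableT_comp mf measurable_fst.
  exact: measurableT_comp mg measurable_snd.
have ifg : ((m1 \x m2)%E.-integrable setT (fun x => (f x.1 * g x.2)%:E)).
  apply/integrable12ltyP => //=.
  under eq_integral => x _.
    under eq_integral do rewrite normrM EFinM.
    rewrite ge0_integralZl//; last first.
      exact/measurable_EFinP/measurableT_comp.
    over.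
  rewrite ge0_integralZr//.
  - apply: lte_mul_pinfty.
    + by apply: integral_ge0 => x _; rewrite lee_fin.
    + have /integrableP[_] := integrable_norm fi.
      rewrite ge0_fin_numE; last by apply: integral_ge0 => x _; rewrite lee_fin.
      apply: le_lt_trans; rewrite le_eqVlt; apply/orP; left; apply/eqP/eq_integral => x _ /=.
      by rewrite normr_id.
    + by have /integrableP[_] := gi.
  - exact/measurable_EFinP/measurableT_comp.
  - by apply: integral_ge0 => x _; rewrite lee_fin.
split=> //.
rewrite /Rintegral -integral12_prod_meas1// /fubini_F/=.
under eq_integral => x _.
  under eq_integral do rewrite EFinM.
  rewrite integralZl//.
  rewrite -[X in (_ * X)%E]fineK; last exact: integrable_fin_num.
  over.
by rewrite integralZr// fineM// integrable_fin_num.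
Qed.

Lemma Rintegral_prod (D1 : set X1) (D2 : set X2) (f : X1 -> R) (g : X2 -> R) :
  measurable D1 -> measurable D2 ->
  m1.-integrable D1 (EFin \o f) -> m2.-integrable D2 (EFin \o g) ->
  ((m1 \x m2)%E.-integrable (D1 `*` D2) (fun x => (f x.1 * g x.2)%:E)) /\
  \int[(m1 \x m2)%E]_(x in D1 `*` D2) (f x.1 * g x.2) =
  (\int[m1]_(x in D1) f x) * (\int[m2]_(x in D2) g x).
Proof.
move=> mD1 mD2 fi gi.
have fi' : m1.-integrable setT (EFin \o (f \_ D1)).
  by rewrite -restrict_EFin; have [+ _] := @integrable_mkcond _ _ _ m1 _ (EFin \o f) mD1; exact.
have gi' : m2.-integrable setT (EFin \o (g \_ D2)).
  by rewrite -restrict_EFin; have [+ _] := @integrable_mkcond _ _ _ m2 _ (EFin \o g) mD2; exact.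
have [ifg efg] := Rintegral_prodT fi' gi'.
have e : (fun x : X1 * X2 => f x.1 * g x.2) \_ (D1 `*` D2) =
    (fun x => (f \_ D1) x.1 * (g \_ D2) x.2).
  apply/funext => -[x y]; rewrite !patchE/= in_setX/=.
  by case: (x \in D1); case: (y \in D2); rewrite ?mul0r ?mulr0.
split.
  apply/integrable_mkcond; first exact: measurableX.
  apply: eq_integrable ifg => //= x _.
  by rewrite -(congr1 (@^~ x) e)/= !patchE; case: ifP.
by rewrite Rintegral_mkcond e efg -!Rintegral_mkcond.
Qed.
End product_integral.

Section fourier.
Context {R : realType}.
Local Open Scope complex_scope.

(** The characteristic function at [r] of the image under [z] of the measure on [D]. The frequency
    vector is hidden in the phase [z], so that one real variable [r] serves on the line, the plane
    and the space. *)
Definition fourier d (X : measurableType d) (m : {measure set X -> \bar R}) (D : set X)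
    (z : X -> R) (r : R) : R[i] :=
  (\int[m]_(x in D) cos (r * z x)) +i* (\int[m]_(x in D) sin (r * z x)).

Lemma integrable_trig d (X : measurableType d) (m : {measure set X -> \bar R})
    (D : set X) (z : X -> R) (r : R) (t : R -> R) :
  measurable D -> (m D < +oo)%E -> measurable_fun setT z ->
  continuous t -> (forall u, `|t u| <= 1) ->
  m.-integrable D (EFin \o (fun x => t (r * z x))).
Proof.
move=> mD Doo mz ct t1; apply: measurable_bounded_integrable => //.
  apply: (@measurable_funS _ _ _ _ setT) => //.
  have mt : measurable_fun setT t by exact: continuous_measurable_fun.
  by apply: measurableT_comp mt _; apply: measurable_funM.
by exists 1; split => // y y1 x _ /=; rewrite (le_trans (t1 _))// ltW.
Qed.

Lemma fourier_prod d1 d2 (X1 : measurableType d1) (X2 : measurableType d2)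
    (m1 : {sigma_finite_measure set X1 -> \bar R})
    (m2 : {sigma_finite_measure set X2 -> \bar R})
    (D1 : set X1) (D2 : set X2) (z1 : X1 -> R) (z2 : X2 -> R) r :
  measurable D1 -> measurable D2 -> (m1 D1 < +oo)%E -> (m2 D2 < +oo)%E ->
  measurable_fun setT z1 -> measurable_fun setT z2 ->
  fourier (m1 \x m2)%E (D1 `*` D2) (fun x => z1 x.1 + z2 x.2) r =
  fourier m1 D1 z1 r * fourier m2 D2 z2 r.
Proof.
move=> mD1 mD2 f1 f2 mz1 mz2.
have c1 : forall u : R, `|cos u| <= 1.
  by move=> u; rewrite ler_norml cos_geN1 cos_le1.
have s1 : forall u : R, `|sin u| <= 1.
  by move=> u; rewrite ler_norml sin_geN1 sin_le1.
have ic1 := integrable_trig r mD1 f1 mz1 (@continuous_cos R) c1.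
have ic2 := integrable_trig r mD2 f2 mz2 (@continuous_cos R) c1.
have is1 := integrable_trig r mD1 f1 mz1 (@continuous_sin R) s1.
have is2 := integrable_trig r mD2 f2 mz2 (@continuous_sin R) s1.
have [icc ecc] := Rintegral_prod mD1 mD2 ic1 ic2.
have [ics ecs] := Rintegral_prod mD1 mD2 ic1 is2.
have [isc esc] := Rintegral_prod mD1 mD2 is1 ic2.
have [iss ess] := Rintegral_prod mD1 mD2 is1 is2.
have mD := measurableX mD1 mD2.
rewrite /fourier; simpc; congr (_ +i* _).
- under eq_Rintegral do rewrite mulrDr cosD.
  by rewrite RintegralB// ecc ess.
- under eq_Rintegral do rewrite mulrDr sinD addrC.
  by rewrite RintegralD// ecs esc.
Qed.

(** The hypothesis says that [z1] and [z2] have the same law. The integral of a signed function is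
    by definition the difference of those of its positive and negative parts, so integrability is
    not an issue. *)
Lemma integral_eq_law d1 d2 (X1 : measurableType d1) (X2 : measurableType d2)
    (m1 : {measure set X1 -> \bar R}) (m2 : {measure set X2 -> \bar R})
    (D1 : set X1) (D2 : set X2) (z1 : X1 -> R) (z2 : X2 -> R) (f : R -> \bar R) :
  (forall g : R -> \bar R, measurable_fun setT g -> (forall x, 0 <= g x)%E ->
    \int[m1]_(x in D1) g (z1 x) = \int[m2]_(x in D2) g (z2 x))%E ->
  measurable_fun setT f ->
  (\int[m1]_(x in D1) f (z1 x) = \int[m2]_(x in D2) f (z2 x))%E.
Proof.
move=> h mf; rewrite integralE [RHS]integralE; congr (_ - _)%E.
- have := h f^\+%E (measurable_funepos mf) (fun x => funepos_ge0 f x).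
  by rewrite unlock.
- have := h f^\-%E (measurable_funeneg mf) (fun x => funeneg_ge0 f x).
  by rewrite unlock.
Qed.

Lemma fourier_eq_law d1 d2 (X1 : measurableType d1) (X2 : measurableType d2)
    (m1 : {measure set X1 -> \bar R}) (m2 : {measure set X2 -> \bar R})
    (D1 : set X1) (D2 : set X2) (z1 : X1 -> R) (z2 : X2 -> R) (r : R) :
  (forall g : R -> \bar R, measurable_fun setT g -> (forall x, 0 <= g x)%E ->
    \int[m1]_(x in D1) g (z1 x) = \int[m2]_(x in D2) g (z2 x))%E ->
  fourier m1 D1 z1 r = fourier m2 D2 z2 r.
Proof.
move=> h.
have mt (t : R -> R) : continuous t -> measurable_fun setT (EFin \o (fun u => t (r * u))).
  move=> ct; apply/measurable_EFinP.
  exact: measurableT_comp (continuous_measurable_fun ct) (mulrl_measurable _).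
congr (_ +i* _); congr fine.
- exact: (integral_eq_law h (mt _ (@continuous_cos R))).
- exact: (integral_eq_law h (mt _ (@continuous_sin R))).
Qed.

End fourier.

(** * From Fourier transforms near 0 to Laplace transforms *)

Section exponential_type_series.
Context {R : realType}.

(** Factoring the term of index [n] out of the tail leaves at most the exponential series of [|u|],
    because [n! j! <= (n + j)!], the binomial coefficient being at least 1. *)
Lemma exp_series_tail (a : nat -> R) (u h : R) (n : nat) :
  (forall k, `|a k| <= 1) -> series (fun k => a k * u ^+ k / k`!%:R) @ \oo --> h ->
  `|h - \sum_(k < n) a k * u ^+ k / k`!%:R| <= `|u| ^+ n / n`!%:R * expR `|u|.
Proof.
move=> a1 cvh.
set s := \sum_(k < n) _.
have cvs : (fun N => `|series (fun k => a k * u ^+ k / k`!%:R) N - s|) @ \oo --> `|h - s|.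
  by apply: cvg_norm; apply: cvgB => //; exact: cvg_cst.
rewrite -(cvg_lim _ cvs)//; apply: limr_le; first by apply/cvg_ex; exists `|h - s|.
near=> N.
have nN : (n <= N)%N by near: N; exact: nbhs_infty_ge.
rewrite /series/= (big_cat_nat (leq0n n) nN)//= big_mkord -/s addrAC subrr add0r.
rewrite -{1}(add0n n) big_addn.
apply: (le_trans (ler_norm_sum _ _ _)).
apply: (@le_trans _ _ (\sum_(0 <= j < N - n) `|u| ^+ n / n`!%:R * (exp_coeff `|u| j))).
  apply: ler_sum => j _; rewrite !normrM normfV normr_nat normrX /exp_coeff/=.
  apply: (@le_trans _ _ (1 * `|u| ^+ (j + n) / (j + n)`!%:R)).
    by rewrite ler_pM2r ?invr_gt0 ?ltr0n ?fact_gt0// ler_wpM2r ?exprn_ge0.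
  rewrite mul1r addnC exprD mulrACA; apply: ler_wpM2l.
    by rewrite mulr_ge0// exprn_ge0.
  rewrite -invfM lef_pV2 ?posrE ?mulr_gt0 ?ltr0n ?fact_gt0//.
  rewrite -natrM ler_nat -(@bin_fact (n + j) n) ?leq_addr// addKn.
  by rewrite leq_pmull// bin_gt0 leq_addr.
rewrite -mulr_sumr; apply: ler_wpM2l; first by rewrite divr_ge0// exprn_ge0.
apply: nondecreasing_cvgn_le; last exact: is_cvg_series_exp_coeff.
apply/nondecreasing_seqP => k; rewrite /series/= big_nat_recr//= lerDl.
exact: exp_coeff_ge0.
Unshelve. all: by end_near. Qed.

(* The Taylor coefficients of [sin + cos] are all nonzero, so that the integrals
   of this single function detect the moments of every order. *)
Definition cas_coeff (k : nat) : R :=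
  (odd k)%:R * (-1) ^+ k.-1./2 + (~~ odd k)%:R * (-1) ^+ k./2.

Lemma normr_cas_coeff k : `|cas_coeff k| = 1.
Proof.
by rewrite /cas_coeff; case: odd; rewrite /= mul1r mul0r ?addr0 ?add0r normrX normrN normr1 expr1n.
Qed.

Lemma cas_series (u : R) :
  series (fun k => cas_coeff k * u ^+ k / k`!%:R) @ \oo --> sin u + cos u.
Proof.
have -> : (fun k => cas_coeff k * u ^+ k / k`!%:R) = sin_coeff u + cos_coeff u.
  by apply/funext => k; rewrite /cas_coeff !mulrDl.
rewrite seriesD unlock; apply: cvgD.
  exact: is_cvg_series_sin_coeff.
rewrite unlock; exact: is_cvg_series_cos_coeff.
Qed.

Lemma expR_series (u : R) : series (fun k => 1 * u ^+ k / k`!%:R) @ \oo --> expR u.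
Proof.
under eq_fun do rewrite mul1r.
exact: is_cvg_series_exp_coeff.
Qed.

End exponential_type_series.

(** Strong induction: once the lower coefficients vanish, the bound of order [n.+1] divided by
    [r ^+ n] reads [|d n| <= K * r], and [r] may be taken arbitrarily small. *)
Lemma asymptotic_coeff_eq0 (R : realType) (d : nat -> R) (r0 : R) : 0 < r0 ->
  (forall n, exists K, forall r, 0 < r < r0 ->
     `|\sum_(k < n) d k * r ^+ k| <= K * r ^+ n) ->
  forall n, d n = 0.
Proof.
move=> r00 h; elim/ltn_ind => n ih.
have [K hK] := h n.+1.
have hd r : 0 < r < r0 -> `|d n| <= K * r.
  move=> rr; have := hK r rr; have /andP[r_gt0 _] := rr.
  rewrite big_ord_recr/= big1 ?add0r => [|i _]; last by rewrite ih ?mul0r.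
  by rewrite normrM (gtr0_norm (exprn_gt0 _ r_gt0)) exprS mulrA ler_pM2r// exprn_gt0.
apply/eqP; rewrite -normr_le0; apply/ler_addgt0Pl => e e0; rewrite addr0.
(* Halving keeps [r] strictly below [r0]; [|K| + 1] replaces [K], whose sign is unknown, by a
   positive divisor. *)
pose r := Num.min (r0 / 2) (e / (`|K| + 1)).
have K1 : 0 < `|K| + 1 by rewrite ltr_wpDl.
have r_gt0 : 0 < r by rewrite lt_min !divr_gt0.
apply: (le_trans (hd r _)).
  by rewrite r_gt0 /= gt_min ltr_pdivrMr// ltr_pMr// ltr1n.
apply: (@le_trans _ _ ((`|K| + 1) * r)).
  by rewrite ler_wpM2r ?ltW//; have := ler_norm K; lra.
by rewrite mulrC -ler_pdivlMr// ge_min lexx orbT.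
Qed.

Section laplace_of_fourier.
Context {R : realType}.

Lemma Rintegral_sum d (X : measurableType d) (m : {measure set X -> \bar R})
    (D : set X) (n : nat) (f : 'I_n -> X -> R) : measurable D ->
  (forall i, m.-integrable D (EFin \o f i)) ->
  m.-integrable D (EFin \o (fun x => \sum_(i < n) f i x)) /\
  \int[m]_(x in D) (\sum_(i < n) f i x) = \sum_(i < n) \int[m]_(x in D) f i x.
Proof.
move=> mD intf; split.
  have := @integrable_sum _ _ _ m _ mD _ (index_enum 'I_n) xpredT (fun i => EFin \o f i)
    (fun i _ => intf i).
  by apply: eq_integrable => // x _ /=; rewrite sumEFin.
rewrite /Rintegral sum_fine => [|i _]; last by apply: integrable_fin_num => //; exact: intf.
have := @integral_sum _ _ _ m _ mD _ _ intf (index_enum 'I_n) xpredT.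
move=> /= <-; congr fine.
by apply: eq_integral => x _; rewrite sumEFin.
Qed.

(** Taylor's formula integrated term by term, with the moments of [z] as coefficients. The function
    [h] is left general in order to treat [sin + cos] for small [r] and [expR] at [r = 1] alike;
    [r <= 1] keeps [r * z x] within [M], so that the remainder is uniform in [r]. *)
Lemma expansion_integral d (X : measurableType d) (m : {measure set X -> \bar R})
    (D : set X) (z : X -> R) (M : R) (a : nat -> R) (h : R -> R) (n : nat) (r : R) :
  measurable D -> (m D < +oo)%E -> measurable_fun setT z ->
  (forall x, D x -> `|z x| <= M) -> 0 <= M ->
  continuous h -> (forall k, `|a k| <= 1) ->
  (forall u, series (fun k => a k * u ^+ k / k`!%:R) @ \oo --> h u) ->
  0 <= r <= 1 ->
  `|\int[m]_(x in D) h (r * z x) -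
    \sum_(k < n) a k * (\int[m]_(x in D) (z x ^+ k)) / k`!%:R * r ^+ k| <=
  M ^+ n / n`!%:R * expR M * fine (m D) * r ^+ n.
Proof.
move=> mD Doo mz zM M0 ch a1 hser /andP[r0 r1].
have bint (t : R -> R) : continuous t -> (exists B, forall u, `|u| <= M -> `|t u| <= B) ->
    m.-integrable D (EFin \o (fun x => t (z x))).
  move=> ct [B tB]; apply: measurable_bounded_integrable => //.
    apply: (@measurable_funS _ _ _ _ setT) => //.
    exact: measurableT_comp (continuous_measurable_fun ct) mz.
  exists B; split; first exact: num_real.
  by move=> y By x Dx /=; rewrite (le_trans (tB _ (zM _ Dx)))// ltW.
have mom_int k : m.-integrable D (EFin \o (fun x => z x ^+ k)).
  apply: (bint (fun u => u ^+ k)); first exact: exprn_continuous.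
  by exists (M ^+ k) => u uM; rewrite normrX lerXn2r// ?nnegrE.
pose P u := \sum_(k < n) a k * u ^+ k / k`!%:R.
have tail u : `|u| <= M -> `|h (r * u) - P (r * u)| <= M ^+ n / n`!%:R * expR M * r ^+ n.
  move=> uM; apply: (le_trans (exp_series_tail n a1 (hser _))).
  have ruM : `|r * u| <= M.
    by rewrite normrM ger0_norm// (le_trans _ uM)// ler_piMl.
  rewrite normrM exprMn (ger0_norm r0).
  rewrite [leRHS](_ : _ = (r ^+ n * M ^+ n / n`!%:R) * expR M); last by ring.
  apply: ler_pM; rewrite ?expR_ge0 ?ler_expR//.
    by rewrite divr_ge0// mulr_ge0 ?exprn_ge0.
    apply: ler_wpM2r; first by rewrite invr_ge0.
    by apply: ler_wpM2l; rewrite ?exprn_ge0// lerXn2r ?nnegrE.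
  by rewrite -(ger0_norm r0) -normrM.
have cmom_int (k : 'I_n) :
    m.-integrable D (EFin \o (fun x => (a k / k`!%:R * r ^+ k) * z x ^+ k)).
  have := @integrableZl _ _ _ m _ mD (a k / k`!%:R * r ^+ k) _ (mom_int k).
  by apply: eq_integrable.
have [Pint' Peq] := Rintegral_sum mD cmom_int.
have PE x : P (r * z x) = \sum_(k < n) (a k / k`!%:R * r ^+ k) * z x ^+ k.
  by apply: eq_bigr => k _; rewrite exprMn; ring.
have Pint : m.-integrable D (EFin \o (fun x => P (r * z x))).
  by apply: eq_integrable Pint' => // x _ /=; rewrite PE.
have hint : m.-integrable D (EFin \o (fun x => h (r * z x))).
  apply: (bint (fun u => h (r * u))).
    move=> u; apply: continuous_comp; last exact: ch.
    exact: mulrl_continuous.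
  exists (expR M) => u uM.
  have := exp_series_tail 0 a1 (hser (r * u)).
  rewrite big_ord0 subr0 expr0 fact0 divr1 mul1r => /le_trans; apply.
  by rewrite ler_expR normrM ger0_norm// (le_trans _ uM)// ler_piMl.
have -> : \sum_(k < n) a k * (\int[m]_(x in D) (z x ^+ k)) / k`!%:R * r ^+ k =
    \int[m]_(x in D) P (r * z x).
  under [RHS]eq_Rintegral do rewrite PE.
  rewrite Peq; apply: eq_bigr => k _.
  by rewrite (RintegralZl _ mD (mom_int k)); ring.
rewrite -RintegralB//.
apply: (le_trans (le_normr_Rintegral mD _)).
  by have := @integrableB _ _ _ m _ mD _ _ hint Pint.
have -> : M ^+ n / n`!%:R * expR M * fine (m D) * r ^+ n =
    \int[m]_(x in D) (M ^+ n / n`!%:R * expR M * r ^+ n).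
  by rewrite Rintegral_cst//; ring.
apply: le_Rintegral => //.
- apply: integrable_norm.
  by have := @integrableB _ _ _ m _ mD _ _ hint Pint.
- apply: measurable_bounded_integrable => //.
  by exists `|M ^+ n / n`!%:R * expR M * r ^+ n|; split; [exact: num_real|move=> y /ltW + x _].
- by move=> x Dx; exact: tail (zM _ Dx).
Qed.

(** Equality of the transforms near 0 forces equality of all moments of [z1] and [z2], and for
    bounded phases the moments determine the integral of the exponential. *)
Lemma laplace_eq_fourier d1 d2 (X1 : measurableType d1) (X2 : measurableType d2)
    (m1 : {measure set X1 -> \bar R}) (m2 : {measure set X2 -> \bar R})
    (D1 : set X1) (D2 : set X2) (z1 : X1 -> R) (z2 : X2 -> R) (M r0 : R) :
  measurable D1 -> (m1 D1 < +oo)%E -> measurable_fun setT z1 ->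
  (forall x, D1 x -> `|z1 x| <= M) ->
  measurable D2 -> (m2 D2 < +oo)%E -> measurable_fun setT z2 ->
  (forall x, D2 x -> `|z2 x| <= M) ->
  0 < r0 -> (forall r, 0 < r < r0 -> fourier m1 D1 z1 r = fourier m2 D2 z2 r) ->
  \int[m1]_(x in D1) expR (z1 x) = \int[m2]_(x in D2) expR (z2 x).
Proof.
move=> mD1 f1 mz1 zM1 mD2 f2 mz2 zM2 r00 hF.
(* A negative [M] is possible when both sets are empty. *)
wlog M0 : M zM1 zM2 / 0 <= M.
  move=> /(_ (Num.max M 0)); apply.
  - by move=> x /zM1 h; rewrite le_max h.
  - by move=> x /zM2 h; rewrite le_max h.
  - by rewrite le_max lexx orbT.
pose mom1 k := \int[m1]_(x in D1) (z1 x ^+ k).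
pose mom2 k := \int[m2]_(x in D2) (z2 x ^+ k).
have ccas : continuous (fun u : R => sin u + cos u).
  by move=> u; apply: cvgD; [exact: continuous_sin|exact: continuous_cos].
have cas1 k : `|@cas_coeff R k| <= 1 by rewrite normr_cas_coeff.
have e1 := fun n r => @expansion_integral _ _ m1 D1 z1 M _ _ n r
  mD1 f1 mz1 zM1 M0 ccas cas1 cas_series.
have e2 := fun n r => @expansion_integral _ _ m2 D2 z2 M _ _ n r
  mD2 f2 mz2 zM2 M0 ccas cas1 cas_series.
have sin1 (u : R) : `|sin u| <= 1 by rewrite ler_norml sin_geN1 sin_le1.
have cos1 (u : R) : `|cos u| <= 1 by rewrite ler_norml cos_geN1 cos_le1.
have hcas r : 0 < r < r0 -> \int[m1]_(x in D1) (sin (r * z1 x) + cos (r * z1 x)) =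
    \int[m2]_(x in D2) (sin (r * z2 x) + cos (r * z2 x)).
  move=> /hF; rewrite /fourier => -[hc hs].
  rewrite !RintegralD//; first by rewrite hc hs.
  - exact: (integrable_trig r mD2 f2 mz2 (@continuous_sin R) sin1).
  - exact: (integrable_trig r mD2 f2 mz2 (@continuous_cos R) cos1).
  - exact: (integrable_trig r mD1 f1 mz1 (@continuous_sin R) sin1).
  - exact: (integrable_trig r mD1 f1 mz1 (@continuous_cos R) cos1).
(* The two expansions of the same function of [r] are subtracted; their difference is a polynomial
   of size [O(r ^+ n)] for every [n]. *)
have mom k : mom1 k = mom2 k.
  pose d k := cas_coeff k * (mom1 k - mom2 k) / k`!%:R : R.
  have d0 : d k = 0.
    apply: (@asymptotic_coeff_eq0 _ d (Num.min r0 1)).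
      by rewrite lt_min r00 ltr01.
    move=> n; eexists => r /andP[r_gt0]; rewrite lt_min => /andP[rr0 r1].
    have r01 : 0 <= r <= 1 by rewrite !ltW.
    have rr : 0 < r < r0 by rewrite r_gt0.
    have := lerD (e2 n r r01) (e1 n r r01).
    rewrite (hcas r rr) -mulrDl => h; apply: le_trans h.
    have E (x y w : R) : (x - y) - (x - w) = w - y by ring.
    apply: (le_trans _ (ler_normB _ _)); rewrite E -sumrB.
    rewrite le_eqVlt; apply/orP; left; apply/eqP; congr `|_|.
    by apply: eq_bigr => i _; rewrite /d /mom1 /mom2; ring.
  have c0 : @cas_coeff R k != 0 by rewrite -normr_eq0 normr_cas_coeff oner_neq0.
  move/eqP: d0; rewrite /d !mulf_eq0 invr_eq0 (negbTE c0) pnatr_eq0/=.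
  by rewrite -(negbK (_ == 0)%N) -lt0n fact_gt0 orbF subr_eq0 => /eqP.
have one1 (k : nat) : `|1 : R| <= 1 by rewrite normr1.
have l1 := fun n => @expansion_integral _ _ m1 D1 z1 M (fun=> 1) expR n 1
  mD1 f1 mz1 zM1 M0 (@continuous_expR R) one1 expR_series.
have l2 := fun n => @expansion_integral _ _ m2 D2 z2 M (fun=> 1) expR n 1
  mD2 f2 mz2 zM2 M0 (@continuous_expR R) one1 expR_series.
have r01 : 0 <= (1 : R) <= 1 by rewrite ler01 lexx.
pose I1 := \int[m1]_(x in D1) expR (z1 x); pose I2 := \int[m2]_(x in D2) expR (z2 x).
have hI1 : \int[m1]_(x in D1) expR (1 * z1 x) = I1.
  by apply: eq_Rintegral => x _; rewrite mul1r.
have hI2 : \int[m2]_(x in D2) expR (1 * z2 x) = I2.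
  by apply: eq_Rintegral => x _; rewrite mul1r.
pose K := expR M * fine (m1 D1) + expR M * fine (m2 D2).
(* With equal moments the Taylor sums cancel, and only the two remainders are left. *)
have bnd n : `|I1 - I2| <= exp_coeff M n * K.
  have := lerD (l1 n r01) (l2 n r01); rewrite hI1 hI2 expr1n !mulr1 => h.
  rewrite [leRHS](_ : _ = M ^+ n / n`!%:R * expR M * fine (m1 D1) +
      M ^+ n / n`!%:R * expR M * fine (m2 D2)); last by rewrite /exp_coeff/= /K; ring.
  apply: le_trans h; apply: (le_trans _ (ler_normB _ _)).
  rewrite le_eqVlt; apply/orP; left; apply/eqP; congr `|_|.
  set s1 := \sum_(k < n) _; set s2 := \sum_(k < n) _.
  have -> : s1 = s2 by apply: eq_bigr => k _; rewrite -/(mom1 k) -/(mom2 k) mom.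
  by rewrite opprB addrA subrK.
apply/eqP; rewrite -subr_eq0 -normr_le0.
have cv : (fun n => exp_coeff M n * K) @ \oo --> 0 * K.
  by apply: cvgMl; exact: cvg_exp_coeff.
rewrite -(mul0r K) -(cvg_lim _ cv)//; apply: limr_ge; first by apply/cvg_ex; exists (0 * K).
by apply: nearW => n; exact: bnd.
Qed.

End laplace_of_fourier.

(** * Bounded sets are determined by their Laplace transforms at the natural numbers *)

Section laplace_uniqueness.
Context {R : realType}.
Local Notation mu := (@lebesgue_measure R).
Local Notation T := (measurableTypeR R).

Lemma lebesgue_measure_bounded (D : set T) (M : R) : measurable D ->
  D `<=` `[- M, M]%classic -> (mu D < +oo)%E.
Proof.
move=> mD DM; apply: (@le_lt_trans _ _ (mu `[- M, M]%classic)).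
  by apply: le_measure; rewrite ?inE//; exact: measurable_itv.
by rewrite lebesgue_measure_itv/=; case: ifP => _; rewrite ?ltry// -EFinB ltry.
Qed.

Lemma integrable_expR (D : set T) (M s : R) : measurable D -> D `<=` `[- M, M]%classic ->
  mu.-integrable D (EFin \o (fun x => expR (s * x))).
Proof.
move=> mD DM; apply: measurable_bounded_integrable => //.
- exact: lebesgue_measure_bounded DM.
- apply: (@measurable_funS _ _ _ _ setT) => //.
  have h : measurable_fun [set: R] (fun x : R => expR (s * x)).
    by apply: measurableT_comp.
  exact: h.
exists (expR (`|s| * M)); split; first exact: num_real.
move=> y yM x /DM/=; rewrite in_itv/= -ler_norml => xM.
rewrite ger0_norm ?expR_ge0// (le_trans _ (ltW yM))// ler_expR.
by rewrite (le_trans (ler_norm _))// normrM ler_wpM2l.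
Qed.

(** Bernoulli's inequality and [1 - y <= expR (- y)]. With [y = x / m] they place [(1 - x / m) ^+ m]
    between [1 - x] and [expR (- x)] as soon as [m >= x], so no limit in [m] is required. *)
Lemma onem_exp_bounds (y : R) (m : nat) : 0 <= y <= 1 ->
  1 - m%:R * y <= (1 - y) ^+ m <= expR (- (m%:R * y)).
Proof.
move=> /andP[y0 y1]; have y1' : 0 <= 1 - y by rewrite subr_ge0.
apply/andP; split.
  elim: m => [|m ih]; first by rewrite mul0r subr0 expr0.
  apply: (@le_trans _ _ ((1 - y) * (1 - m%:R * y))); last by rewrite exprS ler_wpM2l.
  have : 0 <= m%:R * y * y by rewrite !mulr_ge0.
  by rewrite -natr1; lra.
rewrite -mulrN expRM_natl; apply: lerXn2r; rewrite ?nnegrE ?expR_ge0//.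
exact: expR_ge1Dx.
Qed.

(* A polynomial in [expR t], close to [exp (- x)] for [x = N exp (N (t - c))] and
   [N = n.+1], hence to the indicator of [t < c]. *)
Definition step_approx (c : R) (m : nat -> nat) (n : nat) (t : R) : R :=
  (1 - n.+1%:R * expR (n.+1%:R * (t - c)) / (m n)%:R) ^+ (m n).

(** Let [x = N exp (N (t - c))]. If [t < c], then [x] tends to 0 and the lower bound [1 - x]
    decides; if [t >= c], then [x >= N] and the upper bound [expR (- x)] decides. The condition on
    [m] ensures [x <= m] for all [t <= M] at once. *)
Lemma step_approx_cvg (c M : R) (m : nat -> nat) (t : R) :
  (forall n, n.+1%:R * expR (n.+1%:R * (M - c)) <= (m n)%:R) -> t <= M ->
  (forall n, 0 <= step_approx c m n t <= 1) /\
  (step_approx c m n t @[n --> \oo] --> (\1_(`]-oo, c[%classic) t : R)).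
Proof.
move=> hm tM.
pose x n := n.+1%:R * expR (n.+1%:R * (t - c)) : R.
have x0 n : 0 < x n by rewrite mulr_gt0// expR_gt0.
have xm n : x n <= (m n)%:R.
  apply: le_trans (hm n); rewrite ler_pM2l// ler_expR ler_pM2l//; lra.
have m0 n : 0 < (m n)%:R :> R by exact: lt_le_trans (x0 n) (xm n).
have y01 n : 0 <= x n / (m n)%:R <= 1.
  apply/andP; split; first by apply: divr_ge0; apply: ltW.
  by rewrite ler_pdivrMr// mul1r.
have bnd n : 1 - x n <= step_approx c m n t <= expR (- x n).
  have := onem_exp_bounds (m n) (y01 n).
  by rewrite mulrCA mulfV ?gt_eqF// mulr1.
have s01 n : 0 <= step_approx c m n t <= 1.
  have /andP[a b] := y01 n.
  by rewrite exprn_ge0 ?exprn_ile1 ?subr_ge0// lerBlDr lerDl.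
split=> //.
have [K hK] : exists K, forall n,
    `|\1_(`]-oo, c[%classic) t - step_approx c m n t| <= K * harmonic n.
  have [tc|ct] := ltP t c.
  (* The constant comes from [exp s >= 1 + s^2 / 2] at [s = N (c - t)], which gives
     [x <= 2 / ((c - t)^2 N)]. *)
  - exists (2 / (c - t) ^+ 2) => n.
    rewrite indicE mem_set/= ?in_itv//=.
    have /andP[l _] := bnd n; have /andP[_ u] := s01 n.
    rewrite ger0_norm ?subr_ge0//.
    apply: (@le_trans _ _ (x n)); first by lra.
    have e0 : 0 < n.+1%:R * (c - t) by rewrite mulr_gt0// subr_gt0.
    have := expR_ge1Dxn 1 (ltW e0).
    have -> : x n = n.+1%:R / expR (n.+1%:R * (c - t)).
      by rewrite /x -(opprB c t) mulrN expRN.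
    move=> h.
    rewrite ler_pdivrMr ?expR_gt0//.
    apply: (@le_trans _ _ (2 / (c - t) ^+ 2 * harmonic n * ((n.+1%:R * (c - t)) ^+ 2 / 2))).
      rewrite /harmonic/= le_eqVlt; apply/orP; left; apply/eqP.
      field; rewrite gt_eqF ?subr_gt0//=.
      by rewrite subr_eq0 gt_eqF.
    apply: ler_wpM2l.
      by rewrite mulr_ge0 ?divr_ge0 ?exprn_ge0 ?invr_ge0// subr_ge0 ltW.
    by apply: le_trans h; rewrite (_ : 2`! = 2)%N// lerDr.
  - exists 1 => n.
    rewrite indicE memNset/=; last by rewrite in_itv/= ltNge ct.
    have /andP[_ u] := bnd n; have /andP[l _] := s01 n.
    rewrite sub0r normrN ger0_norm// (le_trans u)// mul1r.
    rewrite expRN /harmonic/= lef_pV2 ?posrE ?expR_gt0//.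
    apply: (@le_trans _ _ (x n)); last by have := expR_ge1Dx (x n); lra.
    rewrite /x ler_peMr//.
    by rewrite -expR0 ler_expR mulr_ge0// subr_ge0.
apply/cvgrPdist_le => e e0.
have hcv : (fun n => K * harmonic n) @ \oo --> (0 : R).
  by rewrite -(mulr0 K); apply: cvgMr; exact: cvg_harmonic.
near=> n; apply: (le_trans (hK n)); apply: (le_trans (ler_norm _)).
rewrite -normrN -sub0r; near: n.
by move/cvgrPdist_le : hcv; apply.
Unshelve. all: by end_near. Qed.

(** The hypothesis extends linearly to polynomials in [expR x], then by dominated convergence to
    indicators of rays, and thence to all Borel sets. *)
Lemma laplace_unique (A B : set T) (M : R) : measurable A -> measurable B ->
  A `<=` `[- M, M]%classic -> B `<=` `[- M, M]%classic ->
  (forall j : nat, \int[mu]_(x in A) expR (j%:R * x) = \int[mu]_(x in B) expR (j%:R * x)) ->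
  mu (A `\` B) = 0.
Proof.
move=> mA mB AM BM hL.
have int (D : set T) (j : nat) mD DM := @integrable_expR D M j%:R mD DM.
have polyE (p : {poly R}) : (forall D : set T, measurable D -> D `<=` `[- M, M]%classic ->
    mu.-integrable D (EFin \o (fun x => p.[expR x]))) /\
    \int[mu]_(x in A) p.[expR x] = \int[mu]_(x in B) p.[expR x].
  have pE (x : R) : p.[expR x] = \sum_(j < size p) p`_j * expR (j%:R * x).
    by rewrite horner_coef; apply: eq_bigr => j _; rewrite expRM_natl.
  have int' (D : set T) (j : 'I_(size p)) : measurable D -> D `<=` `[- M, M]%classic ->
     mu.-integrable D (EFin \o (fun x => p`_j * expR (j%:R * x))).
    move=> mD DM; have := @integrableZl _ _ _ mu _ mD p`_j _ (int D j mD DM).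
    by apply: eq_integrable.
  have hD (D : set T) : measurable D -> D `<=` `[- M, M]%classic ->
    mu.-integrable D (EFin \o (fun x => p.[expR x])) /\
    \int[mu]_(x in D) p.[expR x] = \sum_(j < size p) p`_j * \int[mu]_(x in D) expR (j%:R * x).
    move=> mD DM; have [i1 i2] := Rintegral_sum mD (fun j => int' D j mD DM).
    split; first by apply: eq_integrable i1 => // x _ /=; rewrite pE.
    under eq_Rintegral do rewrite pE.
    by rewrite i2; apply: eq_bigr => j _; rewrite RintegralZl//; exact: int.
  split; first by move=> D mD DM; have [] := hD D mD DM.
  have [_ ->] := hD A mA AM; have [_ ->] := hD B mB BM.
  by apply: eq_bigr => j _; rewrite hL.
have ray (c : R) : mu (`]-oo, c[%classic `&` A) = mu (`]-oo, c[%classic `&` B).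
  pose m n := (Num.trunc (n.+1%:R * expR (n.+1%:R * (M - c)) : R)).+1.
  have hm n : n.+1%:R * expR (n.+1%:R * (M - c)) <= (m n)%:R :> R.
    by rewrite ltW// truncnS_gt.
  pose p n : {poly R} := (1 - (n.+1%:R * expR (- (n.+1%:R * c)) / (m n)%:R)%:P * 'X ^+ n.+1) ^+ m n.
  have pE n (t : R) : (p n).[expR t] = step_approx c m n t.
    rewrite /p /step_approx !hornerE; congr ((1 - _) ^+ _).
    rewrite mulrBr expRB expRN -expRM_natl; lra.
  have lim (D : set T) : measurable D -> D `<=` `[- M, M]%classic ->
      (\int[mu]_(x in D) ((p n).[expR x])%:E @[n --> \oo] --> mu (`]-oo, c[%classic `&` D))%E.
    move=> mD DM.
    have DM' x : D x -> x <= M by move=> /DM/=; rewrite in_itv/= => /andP[].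
    have mi : measurable (`]-oo, c[%classic : set T) by exact: measurable_itv.
    rewrite -integral_indic//.
    have [] := @dominated_convergence _ _ _ mu D mD (fun n x => ((p n).[expR x])%:E)
      (fun x => (\1_(`]-oo, c[%classic) x)%:E) (cst 1%E) => //.
    - by move=> n; have [h _] := polyE (p n); exact: measurable_int (h D mD DM).
    - by apply/measurable_EFinP; exact: measurable_indic.
    - apply: aeW => x /= Dx; apply: cvg_EFin; first by apply: nearW => n.
      rewrite [X in X @ _ --> _](_ : _ = step_approx c m ^~ x).
        by have [] := step_approx_cvg hm (DM' _ Dx).
      by apply/funext => n /=; rewrite pE.
    - by have := int D 0%N mD DM; apply: eq_integrable => // x _ /=; rewrite mul0r expR0.
    - apply: aeW => x n Dx /=; rewrite pE lee_fin.
      have [h _] := step_approx_cvg hm (DM' _ Dx).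
      by have /andP[a b] := h n; rewrite ger0_norm.
  have eqn : (fun n => \int[mu]_(x in A) ((p n).[expR x])%:E)%E =
      (fun n => \int[mu]_(x in B) ((p n).[expR x])%:E)%E.
    apply/funext => n; have [h e] := polyE (p n).
    rewrite -[LHS]fineK; last exact: integrable_fin_num (h A mA AM).
    rewrite -[RHS]fineK; last exact: integrable_fin_num (h B mB BM).
    by congr EFin; exact: e.
  have hA := lim A mA AM; rewrite eqn in hA.
  by rewrite -(cvg_lim _ hA)// -(cvg_lim _ (lim B mB BM)).
(* Open left rays are stable under intersection and generate the Borel sets, and the rays ending at
   [n] exhaust the line. *)
have eqm (S : set T) : measurable S -> mrestr mu mA S = mrestr mu mB S.
  move=> mS.
  apply: (@measure_unique _ R T (@RGenInftyO.G R) (fun n => `]-oo, n%:R[%classic)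
     _ _ _ _ (mrestr mu mA) (mrestr mu mB)) => //.
  - exact: RGenInftyO.measurableE.
  - move=> _ _ [x ->] [y ->]; exists (Num.min x y); apply/seteqP; split => z /=.
      by rewrite !in_itv/= lt_min => -[-> ->].
    by rewrite !in_itv/= lt_min => /andP[].
  - by move=> n; exists n%:R.
  - apply/seteqP; split => // x _; exists (Num.bound `|x|) => //=.
    by rewrite in_itv/= (le_lt_trans (ler_norm x))// archi_boundP.
  - by move=> _ [x ->]; exact: ray.
  - move=> n; apply: (le_lt_trans _ (lebesgue_measure_bounded mA AM)).
    apply: le_measure; rewrite ?inE//.
    by apply: measurableI => //; exact: measurable_itv.
(* Tested on this set, the restriction to [A] gives its full measure and the restriction to [B]
   gives 0. *)
have := eqm (A `\` B) (measurableD mA mB).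
rewrite /mrestr setDE setIAC setIid -setIA setICl setI0 measure0.
by rewrite -setDE.
Qed.

End laplace_uniqueness.

(** * Pieces of a set of finite measure *)

(** Almost every section of a null set is null. This permits freezing the first shift of the deck at
    almost every [h]. *)
Lemma ae_product d1 d2 (X1 : measurableType d1) (X2 : measurableType d2) (R : realType)
    (m1 : {sigma_finite_measure set X1 -> \bar R})
    (m2 : {sigma_finite_measure set X2 -> \bar R}) (P : X1 * X2 -> Prop) :
  {ae (m1 \x m2)%E, forall x, P x} ->
  {ae m1, forall x, {ae m2, forall y, P (x, y)}}.
Proof.
move=> [N [mN N0 PN]].
have mx := measurable_fun_xsection m2 mN.
have : ae_eq m1 setT (m2 \o xsection N) (cst 0%E).
  apply/ae_eq_integral_abs => //=.
  rewrite -[RHS]N0; apply: eq_integral => x _.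
  by rewrite gee0_abs.
apply: filterS => x /(_ Logic.I)/= xN0.
exists (xsection N x); split => //; first exact: measurable_xsection.
by move=> y /= nP; rewrite /xsection/= inE; apply: PN.
Qed.

Section deck_basics.
Context {R : realType}.
Local Notation mu := (@lebesgue_measure R).
Local Notation T := (measurableTypeR R).
Local Notation mu2 := (sfprod mu mu).
Implicit Types (A E F : set T).
Local Open Scope ereal_scope.

Lemma measurable_preimageT d (X : measurableType d) (f : X -> T) E :
  measurable_fun setT f -> measurable E -> measurable (f @^-1` E).
Proof. by move=> mf mE; rewrite -[X in measurable X]setTI; exact: mf. Qed.

Lemma measurable_correlation A E : measurable A -> measurable E ->
  measurable_fun setT (fun y : T => mu (A `&` translate E y)).
Proof.
move=> mA mE.
pose S : set (T * T) := snd @^-1` A `&` (fun x => x.2 + x.1 : T)%R @^-1` E.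
have mS : measurable S.
  apply: measurableI; apply: measurable_preimageT => //.
  exact: measurable_addT measurable_snd measurable_fst.
have := measurable_fun_xsection mu mS.
congr (measurable_fun _ _); apply/funext => y /=; congr (mu _).
by rewrite translateE; apply/seteqP; split => t; rewrite /xsection/= inE.
Qed.

Lemma measurable_deck E : measurable E -> measurable_fun setT (deck E).
Proof.
move=> mE.
pose S : set (T * T * T) := snd @^-1` E `&` (fun x => x.2 + x.1.1 : T)%R @^-1` E
  `&` (fun x => x.2 + x.1.2 : T)%R @^-1` E.
have mS : measurable S.
  apply: measurableI; first apply: measurableI; apply: measurable_preimageT => //.
    apply: measurable_addT measurable_snd _.
    exact: measurableT_comp measurable_fst measurable_fst.
  apply: measurable_addT measurable_snd _.
  exact: measurableT_comp measurable_snd measurable_fst.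
have := measurable_fun_xsection mu mS.
congr (measurable_fun _ _); apply/funext => y /=; congr (mu _).
by rewrite !translateE; apply/seteqP; split => t; rewrite /xsection/= inE.
Qed.

Lemma integral_correlation_cst A E : measurable A -> measurable E ->
  \int[mu]_y mu (A `&` translate E y) = mu A * mu E.
Proof.
move=> mA mE.
transitivity (\int[mu]_y (mu (A `&` translate E y) * cst 1 y)).
  by apply: eq_integral => y _; rewrite mule1.
rewrite -(@integral_correlation R A E (cst 1))//.
rewrite integral_cst ?mul1e; last exact: measurableX.
exact: product_measure1E.
Qed.

Lemma integral_deck_cst E : measurable E ->
  \int[mu2]_w deck E w = mu E * mu E * mu E.
Proof.
move=> mE.
transitivity (\int[mu2]_w (deck E w * cst 1 w)).
  by apply: eq_integral => w _; rewrite mule1.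
rewrite -(@integral_deck R E (cst 1))//.
rewrite integral_cst ?mul1e; last by apply: measurableX => //; exact: measurableX.
have mEE := measurableX mE mE.
rewrite [LHS](@product_measure1E _ _ _ _ R mu2 mu _ _ mEE mE).
by congr (_ * _); exact: product_measure1E.
Qed.

Lemma deck_eq_measure E F : measurable E -> measurable F -> mu E < +oo -> 0 < mu E ->
  {ae mu2, forall w, deck F w = deck E w} -> mu F = mu E.
Proof.
move=> mE mF Efin E0 hdeck.
have : \int[mu2]_w deck F w = \int[mu2]_w deck E w.
  apply: ge0_ae_eq_integral => //; try exact: measurable_deck.
  by apply: filterS hdeck => w h _.
rewrite !integral_deck_cst//.
have : 0 <= mu F by [].
rewrite -(fineK (_ : mu E \is a fin_num)) ?ge0_fin_numE//.
have e0 : (0 < fine (mu E))%R by rewrite fine_gt0// E0 Efin.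
move: (mu F) => [x| |]//.
rewrite lee_fin -!EFinM => x0 [h]; congr EFin.
have h3 : (x ^+ 3 = fine (mu E) ^+ 3)%R by rewrite !exprS !expr0 !mulr1 !mulrA.
by move/eqP : h3; rewrite eqrXn2// ?ltW// => /eqP.
Qed.

Definition piece A (h : R) := A `&` translate A h.

Lemma measurable_piece A h : measurable A -> measurable (piece A h : set T).
Proof. by move=> mA; apply: measurableI => //; exact: measurable_translate. Qed.

(* The part A of the piece outside a large interval correlates over ]0, h[ only
   with the tail F' of F, so that h |A| <= |A| |F'|, while |F'| < h. *)
Lemma piece_bounded F (h : R) : measurable F -> mu F < +oo -> (0 < h)%R ->
  {ae mu, forall y : T, (0 < y < h)%R ->
    mu (piece F h `&` translate F y) = mu (piece F h)} ->
  exists M : R, mu (piece F h `\` `[- M, M]%classic)%R = 0.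
Proof.
move=> mF Ffin h0 hy.
pose I (n : nat) : set T := `[- n%:R, n%:R]%classic%R.
have mI n : measurable (I n) by exact: measurable_itv.
have [n Fn] : exists n, mu (F `\` I n) < h%:E.
  have : mu (F `\` I n) @[n --> \oo] --> mu (\bigcap_n (F `\` I n)).
    apply: nonincreasing_cvg_mu => //.
    - by apply: (le_lt_trans _ Ffin); apply: le_measure; rewrite ?inE//; exact: measurableD.
    - by move=> n; exact: measurableD.
    - by apply: bigcap_measurableType => n _; exact: measurableD.
    - move=> n m nm; apply/subsetPset => x [Fx nI]; split => // Ix; apply: nI.
      move: Ix; rewrite /I/= !in_itv/= => /andP[a b].
      have : (n%:R <= m%:R :> R)%R by rewrite ler_nat.
      by move=> ?; apply/andP; split; lra.
  have -> : \bigcap_n (F `\` I n) = set0.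
    apply/seteqP; split => // x /= hx.
    have [_] := hx (Num.bound `|x|%R) Logic.I; apply.
    by rewrite /I/= in_itv/= -ler_norml ltW// archi_boundP.
  rewrite measure0 => /fine_cvgP[fn cv].
  move/cvgrPdist_lt : cv => /(_ h h0) cv.
  have [n _ hn] : (\forall n \near \oo, mu (F `\` I n) \is a fin_num /\
     (`|0 - fine (mu (F `\` I n))| < h)%R) by near=> n; split; near: n.
  exists n; have [fin lt] := hn n (leqnn n).
  rewrite -(fineK fin) lte_fin; move: lt; rewrite sub0r normrN.
  by apply: le_lt_trans; exact: ler_norm.
(* The margin [h] guarantees that a point of [A] shifted by [y < h] still lies outside [I n]. *)
pose F' := F `\` I n; pose A := piece F h `\` `[- (n%:R + h), n%:R + h]%classic%R.
have mF' : measurable F' by exact: measurableD.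
have mp := measurable_piece h mF.
have mA : measurable (A : set T).
  by apply: measurableD => //; exact: measurable_itv.
have Afin : mu A < +oo.
  apply: (le_lt_trans _ Ffin); apply: le_measure; rewrite ?inE//.
  by move=> x [[]].
exists (n%:R + h)%R.
have hA : {ae mu, forall y : T, (0 < y < h)%R -> mu A = mu (A `&` translate F' y)}.
  apply: filterS hy => y + yh => /(_ yh) e.
  have mFy := measurable_translate y mF.
  have mFy' := measurable_translate y mF'.
  have e0 : mu (piece F h `\` translate F y) = 0.
    have pfin : mu (piece F h) < +oo.
      by apply: (le_lt_trans _ Ffin); apply: le_measure; rewrite ?inE// => x [].
    transitivity (mu (piece F h) - mu (piece F h `&` translate F y)).
      exact: measureD.
    by rewrite e subee// ge0_fin_numE.
  rewrite (measureDI mu mA mFy') [X in X + _](_ : _ = 0) ?add0e//.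
  apply: subset_measure0 e0; [exact: measurableD|exact: measurableD|].
  move=> x [[px xI] nx]; split => // Fx; apply: nx; move: Fx; rewrite !translateE/= => Fx.
  split => //; rewrite /I/= in_itv/= => /andP[l u]; apply: xI.
  by rewrite /= in_itv/=; move/andP: yh => [y0 yh]; apply/andP; split; lra.
have [Fn' fF'] : (fine (mu F') < h)%R /\ mu F' \is a fin_num.
  have f : mu F' \is a fin_num by rewrite ge0_fin_numE// (lt_trans Fn)// ltry.
  by split => //; rewrite -lte_fin fineK.
have fA : mu A \is a fin_num by rewrite ge0_fin_numE.
have key : h%:E * mu A <= mu A * mu F'.
  rewrite -integral_correlation_cst//.
  have mc := measurable_correlation mA mF'.
  apply: (@le_trans _ _ (\int[mu]_(y in `]0%R, h[) mu (A `&` translate F' y))); last first.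
    by apply: ge0_subset_integral => //; exact: measurable_itv.
  have mu0h : mu `]0%R, h[%classic = h%:E.
    by rewrite lebesgue_measure_itv/= lte_fin h0 oppr0 adde0.
  have <- : \int[mu]_(y in `]0%R, h[) mu A = h%:E * mu A.
    rewrite muleC -mu0h.
    exact: (@integral_cst _ _ _ mu `]0%R, h[%classic (measurable_itv _) (mu A)).
  apply: ae_ge0_le_integral => //.
  by apply: (@measurable_funS _ _ _ _ setT) => //; exact: mc.
  by apply: filterS hA => y + /=; rewrite in_itv/= => + yh => /(_ yh) <-.
move: key; rewrite -(fineK fA) -(fineK fF') -!EFinM lee_fin => key.
congr EFin; apply/eqP; rewrite eq_le fine_ge0// andbT.
rewrite leNgt; apply/negP => pos.
by move: key; rewrite mulrC ler_pM2l// leNgt Fn'.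
Unshelve. all: by end_near. Qed.

End deck_basics.

(** * Fourier and Laplace transforms determined by the 3-deck *)

Section fourier_lebesgue.
Context {R : realType}.
Local Notation mu := (@lebesgue_measure R).
Local Notation T := (measurableTypeR R).
Local Notation mu2 := (sfprod mu mu).
Implicit Types (A B E F : set T) (c r : R).

Definition laplace (D : set T) (s : R) : R := \int[mu]_(x in D) expR (s * x).

Let measurable_scale c : measurable_fun [set: T] (fun x : T => (c * x)%R : R).
Proof. exact: (@mulrl_measurable R setT c). Qed.

(** The real part equals the measure of [E] at [r = 0] and is continuous in [r] by domination by the
    constant 1. *)
Lemma fourier_neq0 E c : measurable E -> (mu E < +oo)%E -> (0 < mu E)%E ->
  exists2 r0, 0 < r0 & forall r, 0 < r < r0 -> fourier mu E (fun x : T => c * x) r != 0.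
Proof.
move=> mE Efin E0.
pose f (r : R) (x : T) : R := cos (r * (c * x)).
have cos1 (u : R) : `|cos u| <= 1 by rewrite ler_norml cos_geN1 cos_le1.
have intf (r : R) : mu.-integrable E (EFin \o f r).
  exact: (integrable_trig r mE Efin (measurable_scale c) (@continuous_cos R) cos1).
have int1 : mu.-integrable E (EFin \o cst (1 : R)).
  apply: measurable_bounded_integrable => //.
  by exists 1; split; [exact: num_real|move=> y /ltW y1 x _; rewrite /= normr1].
have hc := @continuity_under_integral R _ T mu f E mE (-1) 1 (fun r _ => intf r).
have cf : {ae mu, forall y, E y -> {in (`]-1, 1[%classic : set R), continuous (f ^~ y)}}.
  apply: aeW => y _ u _; apply: continuous_comp; last exact: continuous_cos.
  by apply: continuousM; [exact: cvg_id|exact: cst_continuous].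
have gub : forall r, (`]-1, 1[%classic : set R) r ->
    {ae mu, forall y, E y -> `|f r y| <= (cst 1 : T -> R) y}.
  by move=> r _; apply: aeW => y _; exact: cos1.
have c0 : {for (0 : R), continuous (fun l => \int[mu]_(x in E) f l x)}.
  by apply: (hc cf _ int1 gub); rewrite inE/= in_itv/= ltrN10 ltr01.
have F0 : \int[mu]_(x in E) f 0 x = fine (mu E).
  under eq_Rintegral do rewrite /f mul0r cos0.
  by rewrite Rintegral_cst// mul1r.
have pos : 0 < fine (mu E) by rewrite fine_gt0// E0.
have /nbhs_ballP[r0 /= r00 h] : \forall r \near (0 : R),
    `|fine (mu E) - \int[mu]_(x in E) f r x| < fine (mu E).
  by rewrite -F0 in pos *; move/cvgrPdist_lt : c0; apply.
exists r0 => // r /andP[r_gt0 rr0].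
have := h r; rewrite /ball/= sub0r normrN gtr0_norm// => /(_ rr0).
rewrite /fourier eq_complex/= negb_and => hr.
apply/orP; left; apply: contraTneq hr => ->.
by rewrite subr0 gtr0_norm// ltxx.
Qed.

(** Opposite frequencies make the phase [c * (x.2 - x.1)], so each product is an integral against
    the correlation, for which almost everywhere equality is enough. *)
Lemma fourier_correlation A B E F c r :
  measurable A -> measurable B -> measurable E -> measurable F ->
  (mu A < +oo)%E -> (mu B < +oo)%E -> (mu E < +oo)%E -> (mu F < +oo)%E ->
  {ae mu, forall y : T, mu (A `&` translate E y) = mu (B `&` translate F y)} ->
  fourier mu A (fun x : T => - c * x) r * fourier mu E (fun x : T => c * x) r =
  fourier mu B (fun x : T => - c * x) r * fourier mu F (fun x : T => c * x) r.
Proof.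
move=> mA mB mE mF fA fB fE fF h.
rewrite -!fourier_prod//.
apply: fourier_eq_law => g mg g0.
have mgc : measurable_fun setT (fun y : T => g (c * y)).
  exact: measurableT_comp mg (measurable_scale c).
have corrE D D' : measurable D -> measurable D' ->
    (\int[(mu \x mu)%E]_(x in D `*` D') g (- c * x.1 + c * x.2)%R =
     \int[mu]_y (mu (D `&` translate D' y) * g (c * y)%R))%E.
  move=> mD mD'; rewrite -(@integral_correlation R D D' (fun y => g (c * y)))//.
  by apply: eq_integral => x _; congr g; ring.
rewrite (corrE A E mA mE) (corrE B F mB mF).
apply: ge0_ae_eq_integral => //.
- by apply: emeasurable_funM => //; exact: measurable_correlation.
- by apply: emeasurable_funM => //; exact: measurable_correlation.
- by move=> y _; rewrite mule_ge0.
- by move=> y _; rewrite mule_ge0.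
by move: h; apply: filterS => y -> _.
Qed.

(** As [s = - (p + q)], the phase [p x1 + q x2 + s x3] equals [p (x1 - x3) + q (x2 - x3)]: it
    depends on the differences only, whose joint law has the deck as density. *)
Lemma fourier_deck E F (p q s : R) r : p + q + s = 0 ->
  measurable E -> measurable F -> (mu E < +oo)%E -> (mu F < +oo)%E ->
  {ae mu2, forall w, deck F w = deck E w} ->
  fourier mu F (fun x : T => p * x) r * fourier mu F (fun x : T => q * x) r *
    fourier mu F (fun x : T => s * x) r =
  fourier mu E (fun x : T => p * x) r * fourier mu E (fun x : T => q * x) r *
    fourier mu E (fun x : T => s * x) r.
Proof.
move=> pqs mE mF fE fF h.
have fXX D : measurable D -> (mu D < +oo)%E -> (mu2 (D `*` D) < +oo)%E.
  move=> mD fD; rewrite [X in (X < _)%E](_ : _ = mu D * mu D)%E.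
    by rewrite lte_mul_pinfty// ge0_fin_numE.
  exact: product_measure1E.
have msum : measurable_fun setT (fun x : T * T => p * x.1 + q * x.2 : R).
  apply: measurable_funD.
    exact: measurableT_comp (measurable_scale p) measurable_fst.
  exact: measurableT_comp (measurable_scale q) measurable_snd.
have prodE D : measurable D -> (mu D < +oo)%E ->
  fourier mu D (fun x : T => p * x) r * fourier mu D (fun x : T => q * x) r *
    fourier mu D (fun x : T => s * x) r =
  fourier (mu2 \x mu)%E ((D `*` D) `*` D) (fun x => (p * x.1.1 + q * x.1.2) + s * x.2) r.
  move=> mD fD.
  rewrite [RHS](@fourier_prod R _ _ _ _ mu2 mu _ _ (fun x : T * T => p * x.1 + q * x.2)
    (fun x : T => s * x) r (measurableX mD mD) mD (fXX _ mD fD) fD msum (measurable_scale s)).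
  congr (_ * _); exact/esym/fourier_prod.
rewrite !prodE//.
apply: fourier_eq_law => g mg g0.
pose G (w : T * T) := g (p * w.1 + q * w.2).
have mG : measurable_fun setT G by exact: measurableT_comp mg msum.
have deckE D : measurable D ->
    (\int[mu2 \x mu]_(x in (D `*` D) `*` D) g (p * x.1.1 + q * x.1.2 + s * x.2)%R =
     \int[mu2]_w (deck D w * G w))%E.
  move=> mD; rewrite -(@integral_deck R D G)//; last by move=> x; exact: g0.
  apply: eq_integral => x _; rewrite /G/=; congr g.
  have -> : s = - (p + q) by apply/eqP; rewrite -addr_eq0 addrC pqs.
  by ring.
rewrite (deckE F mF) (deckE E mE).
apply: ge0_ae_eq_integral => //.
- by apply: emeasurable_funM => //; exact: (measurable_deck mF).
- by apply: emeasurable_funM => //; exact: (measurable_deck mE).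
- by move=> y _; rewrite mule_ge0// g0.
- by move=> y _; rewrite mule_ge0// g0.
by apply: filterS h => w; rewrite /deck => -> _.
Qed.

End fourier_lebesgue.

Section laplace_triple.
Context {R : realType}.
Local Notation mu := (@lebesgue_measure R).
Local Notation T := (measurableTypeR R).
Local Notation mu2 := (sfprod mu mu).
Implicit Types (A B D E F : set T).

(** Abstracts what is used of the pieces of [E] and [F] at a common shift, once trimmed to a bounded
    interval. *)
Definition matched E F (M : R) A B :=
  [/\ measurable A, measurable B, A `<=` `[- M, M]%classic, B `<=` `[- M, M]%classic &
    {ae mu, forall y : T, mu (A `&` translate E y) = mu (B `&` translate F y)}].

(** The minus signs are those of [fourier_correlation], which pairs [A] at [- c] with [E] at [c].
    Below the three radii of [fourier_neq0] the transforms of [E] can be cancelled. *)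
Lemma laplace_triple E F (M p q s : R) A1 A2 A3 B1 B2 B3 : p + q + s = 0 ->
  measurable E -> measurable F -> (mu E < +oo)%E -> (mu F < +oo)%E -> (0 < mu E)%E ->
  {ae mu2, forall w, deck F w = deck E w} ->
  matched E F M A1 B1 -> matched E F M A2 B2 -> matched E F M A3 B3 ->
  laplace A1 (- p) * laplace A2 (- q) * laplace A3 (- s) =
  laplace B1 (- p) * laplace B2 (- q) * laplace B3 (- s).
Proof.
move=> pqs mE mF fE fF E0 hd [mA1 mB1 AM1 BM1 c1] [mA2 mB2 AM2 BM2 c2] [mA3 mB3 AM3 BM3 c3].
have fin D mD DM := @lebesgue_measure_bounded R D M mD DM.
have [r1 r10 n1] := fourier_neq0 p mE fE E0.
have [r2 r20 n2] := fourier_neq0 q mE fE E0.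
have [r3 r30 n3] := fourier_neq0 s mE fE E0.
pose z (x : T * T * T) : R := (- p * x.1.1 + - q * x.1.2) + - s * x.2.
have mscale c : measurable_fun [set: T] (fun x : T => (c * x)%R : R).
  exact: (@mulrl_measurable R setT c).
have msum : measurable_fun setT (fun x : T * T => - p * x.1 + - q * x.2 : R).
  apply: measurable_funD.
    exact: measurableT_comp (mscale (- p)) measurable_fst.
  exact: measurableT_comp (mscale (- q)) measurable_snd.
have mz : measurable_fun setT z.
  apply: measurable_funD.
    exact: measurableT_comp msum measurable_fst.
  exact: measurableT_comp (mscale (- s)) measurable_snd.
have fXX D D' : measurable D -> (mu D < +oo)%E -> measurable D' -> (mu D' < +oo)%E ->
    (mu2 (D `*` D') < +oo)%E.
  move=> mD fD mD' fD'; rewrite [X in (X < _)%E](_ : _ = mu D * mu D')%E.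
    by rewrite lte_mul_pinfty// ge0_fin_numE.
  exact: product_measure1E.
have fourierE D1 D2 D3 r : measurable D1 -> measurable D2 -> measurable D3 ->
  (mu D1 < +oo)%E -> (mu D2 < +oo)%E -> (mu D3 < +oo)%E ->
  fourier (mu2 \x mu)%E ((D1 `*` D2) `*` D3) z r =
  fourier mu D1 (fun x : T => - p * x) r * fourier mu D2 (fun x : T => - q * x) r *
    fourier mu D3 (fun x : T => - s * x) r.
  move=> m1 m2 m3 f1 f2 f3.
  rewrite [LHS](@fourier_prod R _ _ _ _ mu2 mu _ _ (fun x : T * T => - p * x.1 + - q * x.2)
    (fun x : T => - s * x) r (measurableX m1 m2) m3 (fXX _ _ m1 f1 m2 f2) f3 msum (mscale (- s))).
  congr (_ * _); exact: fourier_prod.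
have laplaceE D1 D2 D3 : measurable D1 -> measurable D2 -> measurable D3 ->
  D1 `<=` `[- M, M]%classic -> D2 `<=` `[- M, M]%classic -> D3 `<=` `[- M, M]%classic ->
  \int[(mu2 \x mu)%E]_(x in (D1 `*` D2) `*` D3) expR (z x) =
  laplace D1 (- p) * laplace D2 (- q) * laplace D3 (- s).
  move=> m1 m2 m3 M1 M2 M3.
  have [i12 e12] :=
    Rintegral_prod m1 m2 (integrable_expR (- p) m1 M1) (integrable_expR (- q) m2 M2).
  have := @Rintegral_prod _ _ _ _ R mu2 mu (D1 `*` D2) D3
    (fun x => expR (- p * x.1) * expR (- q * x.2)) (fun x => expR (- s * x))
    (measurableX m1 m2) m3 i12 (integrable_expR (- s) m3 M3).
  move=> [_ e]; rewrite /z; under eq_Rintegral do rewrite !expRD.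
  by rewrite [LHS]e; congr (_ * _); exact: e12.
rewrite -!laplaceE//.
have zM D1 D2 D3 : D1 `<=` `[- M, M]%classic -> D2 `<=` `[- M, M]%classic ->
    D3 `<=` `[- M, M]%classic ->
    forall x, ((D1 `*` D2) `*` D3) x -> `|z x| <= (`|p| + `|q| + `|s|) * M.
  move=> M1 M2 M3 x [[/M1 h1 /M2 h2] /M3 h3]; move: h1 h2 h3.
  rewrite /= !in_itv/= -!ler_norml => h1 h2 h3.
  rewrite /z (le_trans (ler_normD _ _))// mulrDl lerD//.
    rewrite (le_trans (ler_normD _ _))// mulrDl lerD// normrM normrN ler_wpM2l//.
  by rewrite normrM normrN ler_wpM2l.
have fin3 D1 D2 D3 : measurable D1 -> measurable D2 -> measurable D3 ->
  (mu D1 < +oo)%E -> (mu D2 < +oo)%E -> (mu D3 < +oo)%E ->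
  ((mu2 \x mu) ((D1 `*` D2) `*` D3) < +oo)%E.
  move=> m1 m2 m3 f1 f2 f3.
  rewrite [X in (X < _)%E](_ : _ = mu2 (D1 `*` D2) * mu D3)%E.
    have f12 := fXX _ _ m1 f1 m2 f2.
    by rewrite lte_mul_pinfty// ge0_fin_numE.
  exact: (@product_measure1E _ _ _ _ R mu2 mu _ _ (measurableX m1 m2) m3).
apply: (@laplace_eq_fourier R _ _ _ _ (mu2 \x mu)%E (mu2 \x mu)%E _ _ z z
  ((`|p| + `|q| + `|s|) * M) (Num.min r1 (Num.min r2 r3))) => //.
- by apply: measurableX => //; exact: measurableX.
- by apply: fin3 => //; exact: fin.
- exact: zM.
- by apply: measurableX => //; exact: measurableX.
- by apply: fin3 => //; exact: fin.
- exact: zM.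
- by rewrite !lt_min r10 r20 r30.
move=> r /andP[r_gt0]; rewrite !lt_min => /and3P[l1 l2 l3].
rewrite !fourierE//; try exact: fin.
have e1 := fourier_correlation p r mA1 mB1 mE mF (fin _ mA1 AM1) (fin _ mB1 BM1) fE fF c1.
have e2 := fourier_correlation q r mA2 mB2 mE mF (fin _ mA2 AM2) (fin _ mB2 BM2) fE fF c2.
have e3 := fourier_correlation s r mA3 mB3 mE mF (fin _ mA3 AM3) (fin _ mB3 BM3) fE fF c3.
have ed := fourier_deck r pqs mE mF fE fF hd.
have ne : fourier mu E (fun x : T => p * x) r * fourier mu E (fun x : T => q * x) r *
    fourier mu E (fun x : T => s * x) r != 0.
  apply: mulf_neq0; last by apply: n3; rewrite r_gt0.
  by apply: mulf_neq0; [apply: n1|apply: n2]; rewrite r_gt0.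
(* After multiplication by the transforms of [E], each [A] is paired with [E] and exchanged for [B]
   paired with [F]; [ed] identifies the leftover products of [E] and [F]. *)
apply: (mulIf ne).
rewrite mulrACA [X in X * _]mulrACA e1 e2 e3 -ed.
by rewrite [RHS]mulrACA [X in _ = X * _]mulrACA.
Qed.

End laplace_triple.

(** * Recovering the translation *)

Section translation_recovery.
Context {R : realType}.
Local Notation mu := (@lebesgue_measure R).
Local Notation T := (measurableTypeR R).
Local Notation mu2 := (sfprod mu mu).
Implicit Types (A B D E F : set T).

Lemma laplace0 D : measurable D -> laplace D 0 = fine (mu D).
Proof.
move=> mD; rewrite /laplace; under eq_Rintegral do rewrite mul0r expR0.
by rewrite Rintegral_cst// mul1r.
Qed.

Lemma laplace_gt0 D (M s : R) : measurable D -> D `<=` `[- M, M]%classic ->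
  (0 < mu D)%E -> 0 < laplace D s.
Proof.
move=> mD DM D0.
have fD := lebesgue_measure_bounded mD DM.
apply: (@lt_le_trans _ _ (expR (- (`|s| * M)) * fine (mu D))).
  by rewrite mulr_gt0 ?expR_gt0// fine_gt0// D0.
rewrite -Rintegral_cst//; apply: le_Rintegral => //.
- apply: measurable_bounded_integrable => //.
  by exists `|expR (- (`|s| * M))|; split; [exact: num_real|move=> y /ltW + x _].
- exact: integrable_expR DM.
move=> x /DM/=; rewrite in_itv/= -ler_norml => xM.
rewrite ler_expR lerNl (le_trans (ler_norm _))// normrN normrM ler_wpM2l//.
Qed.

Lemma matched_le E F (M M' : R) A B : M <= M' -> matched E F M A B -> matched E F M' A B.
Proof.
move=> MM [mA mB AM BM c]; split => //.
  move=> x /AM/=; rewrite !in_itv/= => /andP[a b].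
  by rewrite (le_trans b MM) andbT (le_trans _ a)// lerN2.
move=> x /BM/=; rewrite !in_itv/= => /andP[a b].
by rewrite (le_trans b MM) andbT (le_trans _ a)// lerN2.
Qed.

(** Frequencies [s, - s, 0] applied to [A, A0, A0] and to [A0] three times show that [phi] and
    [phi0] have the same inverse [phi0 (- s)]; the factor at 0 drops out because the measures agree.
    Frequencies [s, 1, - (s + 1)] make [phi0] multiplicative. *)
Lemma laplace_ratio E F (M M0 : R) A0 B0 A B :
  measurable E -> measurable F -> (mu E < +oo)%E -> (mu F < +oo)%E -> (0 < mu E)%E ->
  {ae mu2, forall w, deck F w = deck E w} ->
  matched E F M0 A0 B0 -> (0 < mu A0)%E -> mu A0 = mu B0 ->
  matched E F M A B -> (0 < mu A)%E -> mu A = mu B ->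
  forall j : nat, laplace A j%:R = (laplace A0 1 / laplace B0 1) ^+ j * laplace B j%:R.
Proof.
move=> mE mF fE fF E0 hd m0 A00 AB0 m1 A10 AB1.
(* [laplace_triple] wants all the sets in one interval. *)
wlog MM : M M0 m0 m1 / M = M0.
  move=> /(_ (Num.max M M0) (Num.max M M0)); apply => //.
    by apply: matched_le m0; rewrite le_max lexx orbT.
  by apply: matched_le m1; rewrite le_max lexx.
rewrite {}MM in m1.
have triple (p q s : R) A1 A2 A3 B1 B2 B3 : p + q + s = 0 ->
    matched E F M0 A1 B1 -> matched E F M0 A2 B2 -> matched E F M0 A3 B3 ->
    laplace A1 p * laplace A2 q * laplace A3 s = laplace B1 p * laplace B2 q * laplace B3 s.
  move=> pqs h1 h2 h3; rewrite -(opprK p) -(opprK q) -(opprK s).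
  apply: (laplace_triple _ mE mF fE fF E0 hd h1 h2 h3).
  by rewrite -!opprD pqs oppr0.
have [mA mB AM BM _] := m1; have [mA0 mB0 AM0 BM0 _] := m0.
have B00 : (0 < mu B0)%E by rewrite -AB0.
have B10 : (0 < mu B)%E by rewrite -AB1.
have a0 s := lt0r_neq0 (laplace_gt0 s mA AM A10).
have b0 s := lt0r_neq0 (laplace_gt0 s mB BM B10).
have a00 s := lt0r_neq0 (laplace_gt0 s mA0 AM0 A00).
have b00 s := lt0r_neq0 (laplace_gt0 s mB0 BM0 B00).
pose phi s := laplace A s / laplace B s; pose phi0 s := laplace A0 s / laplace B0 s.
have phi0_0 : laplace A0 0 = laplace B0 0 by rewrite !laplace0// AB0.
have inv0 s : phi0 s * phi0 (- s) = 1.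
  have := triple s (- s) 0 _ _ _ _ _ _ _ m0 m0 m0.
  rewrite addr0 subrr phi0_0 => /(_ erefl)/(mulIf (b00 0)) e.
  by rewrite /phi0 mulf_div e mulfV// mulf_neq0.
have inv s : phi s * phi0 (- s) = 1.
  have := triple s (- s) 0 _ _ _ _ _ _ _ m1 m0 m0.
  rewrite addr0 subrr phi0_0 => /(_ erefl)/(mulIf (b00 0)) e.
  by rewrite /phi /phi0 mulf_div e mulfV// mulf_neq0.
have phi0N s : phi0 (- s) != 0 by rewrite mulf_neq0 ?invr_eq0.
have phiE s : phi s = phi0 s by apply: (mulIf (phi0N s)); rewrite inv inv0.
have phi0D s : phi0 (s + 1) = phi0 s * phi0 1.
  apply: (mulIf (phi0N (s + 1))); rewrite inv0.
  have := triple s 1 (- (s + 1)) _ _ _ _ _ _ _ m0 m0 m0.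
  rewrite subrr => /(_ erefl) e.
  by rewrite /phi0 !mulf_div e mulfV// !mulf_neq0.
have phi0n (j : nat) : phi0 j%:R = phi0 1 ^+ j.
  elim: j => [|j ih]; first by rewrite expr0 /phi0 phi0_0 mulfV.
  by rewrite -natr1 phi0D ih exprSr.
move=> j; rewrite -/(phi0 1) -phi0n -phiE /phi mulfVK//.
Qed.

Lemma laplace_translate D (M s a : R) : measurable D -> D `<=` `[- M, M]%classic ->
  laplace (translate D (- a)) s = expR (a * s) * laplace D s.
Proof.
move=> mD DM.
have mDa := measurable_translate (- a) mD.
rewrite /laplace -RintegralZl//; last exact: integrable_expR DM.
rewrite /Rintegral; congr fine.
pose f (x : T) := ((\1_D x)%:E * (expR (s * (x + a)))%:E)%E.
have mf : measurable_fun setT f.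
  apply: emeasurable_funM; first exact/measurable_EFinP/measurable_indic.
  apply/measurable_EFinP.
  have h : measurable_fun [set: R] (fun x : R => expR (s * (x + a))).
    apply: measurableT_comp => //; apply: measurable_funM => //.
    by apply: measurable_funD.
  exact: h.
have f0 x : (0 <= f x)%E by rewrite mule_ge0// lee_fin ?expR_ge0.
rewrite integral_mkcond [RHS]integral_mkcond.
transitivity (\int[mu]_x f (x + - a)%R)%E.
  apply: eq_integral => x _; rewrite /f patchE -indic_translate subrK indicE.
  by case: (x \in _); rewrite ?mul1e ?mul0e.
rewrite (ge0_integral_shift (- a) mf f0); apply: eq_integral => x _.
rewrite /f patchE indicE mulrDr expRD (mulrC a) (mulrC (expR (s * x))).
by case: (x \in _); rewrite ?mul1e ?mul0e.
Qed.

(** The factor [w ^+ j = expR (a * j)] is the effect on the transform of moving [B] by [a], so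
    Laplace uniqueness applies on an interval enlarged by [|a|]. *)
Lemma matched_translate E F (M a w : R) A B : matched E F M A B -> expR a = w ->
  (forall j : nat, laplace A j%:R = w ^+ j * laplace B j%:R) ->
  mu (A `\` translate B (- a)) = 0 /\ mu (translate B (- a) `\` A) = 0.
Proof.
move=> [mA mB AM BM _] aw h.
have mBa := measurable_translate (- a) mB.
have AM' : A `<=` `[- (M + `|a|), M + `|a|]%classic.
  move=> x /AM/=; rewrite !in_itv/= => /andP[l u].
  by have := normr_ge0 a => ?; apply/andP; split; lra.
have BM' : translate B (- a) `<=` `[- (M + `|a|), M + `|a|]%classic.
  rewrite translateE => x /= /BM/=; rewrite !in_itv/= => /andP[l u].
  have := ler_norm a; have := ler_norm (- a); rewrite normrN => ? ?.
  by apply/andP; split; lra.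
have hL (j : nat) : laplace A j%:R = laplace (translate B (- a)) j%:R.
  by rewrite h (laplace_translate _ _ mB BM) expRM_natr aw.
split; first exact: (laplace_unique mA mBa AM' BM' hL).
by apply: (laplace_unique mBa mA BM' AM') => j; exact/esym/hL.
Qed.

Lemma ae_exists_itv (P : T -> Prop) (a b : R) : a < b -> {ae mu, forall x, P x} ->
  exists2 x : R, a < x < b & P x.
Proof.
move=> ab [N [mN N0 PN]]; apply: contrapT => hn.
have : (mu `]a, b[%classic <= mu N)%E.
  apply: le_measure; rewrite ?inE//.
  move=> x /=; rewrite in_itv/= => xab; apply: PN => /= Px.
  by apply: hn; exists x.
rewrite N0 lebesgue_measure_itv/= lte_fin ab -EFinB lee_fin.
by rewrite subr_le0 leNgt ab.
Qed.

(** Since [E] is open, each of its points belongs to [piece E h] for all small [h]; dominated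
    convergence on [E], of finite measure, concludes. *)
Lemma piece_cvg E (h : nat -> R) : open (E : set R) -> (mu E < +oo)%E ->
  (forall n, 0 < h n) -> h n @[n --> \oo] --> 0 ->
  mu (E `\` piece E (h n)) @[n --> \oo] --> 0%E.
Proof.
move=> oE fE h0 hcv.
have mE : measurable E by exact: open_measurable.
have mD n : measurable (E `\` piece E (h n)) by apply: measurableD => //; exact: measurable_piece.
have mI n : measurable_fun E (fun x : T => (\1_(E `\` piece E (h n)) x)%:E : \bar R).
  by apply/measurable_EFinP; exact: measurable_indic.
have cI : {ae mu, forall x : T, E x ->
    (\1_(E `\` piece E (h n)) x)%:E @[n --> \oo] --> (0 : \bar R)%E}.
  apply: aeW => x Ex.
  have /nbhs_ballP[r /= r0 xr] : nbhs (x : R) E by move: oE; rewrite openE; apply.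
  have hr : \forall n \near \oo, h n < r.
    move/cvgrPdist_lt : hcv => /(_ r r0); apply: filterS => n.
    by rewrite sub0r normrN gtr0_norm.
  apply: cvg_near_cst; apply: filterS hr => n hn.
  rewrite indicE memNset// => -[_]; apply; split => //.
  rewrite translateE/=; apply: xr; rewrite /ball/= opprD addrA subrr sub0r normrN.
  by rewrite gtr0_norm.
have i1 : mu.-integrable E (cst 1%E : T -> \bar R).
  apply: (@measurable_bounded_integrable _ _ _ mu (fun=> 1)) => //.
  by exists 1; split; [exact: num_real|move=> y /ltW y1 x _; rewrite /= normr1].
have b1 : {ae mu, forall (x : T) n, E x ->
    (`|(\1_(E `\` piece E (h n)) x)%:E| <= (cst 1 : T -> \bar R) x)%E}.
  apply: aeW => x n _ /=; rewrite ger0_norm ?indicE ?ler0n// lee_fin.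
  by case: (_ \in _).
have [_ _] := @dominated_convergence _ _ _ mu E mE _ (cst 0%E) (cst 1%E) mI
  (measurable_cst _) cI i1 b1.
rewrite integral0 => c.
rewrite (_ : (fun n => mu _) =
  (fun n => \int[mu]_(x in E) (\1_(E `\` piece E (h n)) x)%:E)%E)//.
apply/funext => n; rewrite integral_indic//; congr (mu _).
by apply/seteqP; split => x []//; case.
Qed.

End translation_recovery.

(** * The theorem for a Borel set [F] *)

Section core.
Context {R : realType}.
Local Notation mu := (@lebesgue_measure R).
Local Notation T := (measurableTypeR R).
Local Notation mu2 := (sfprod mu mu).
Implicit Types (A B D E F : set T).

Theorem translate_of_deck E F (delta : R) : open (E : set R) -> measurable F ->
  (mu E < +oo)%E -> (0 < mu E)%E -> 0 < delta ->
  (forall y h, 0 < y < h -> h < delta -> piece E h `<=` translate E y) ->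
  {ae mu2, forall w, deck F w = deck E w} ->
  exists a : R, mu (F `+` translate E a) = 0.
Proof.
move=> oE mF fE E0 d0 gap hd.
have mE : measurable E by exact: open_measurable.
have FE : mu F = mu E := deck_eq_measure mE mF fE E0 hd.
have fF : (mu F < +oo)%E by rewrite FE.
pose good (h : R) := {ae mu, forall y : T,
  mu (piece F h `&` translate F y) = mu (piece E h `&` translate E y)}.
have hgood : {ae mu, forall h : T, good h}.
  by have := ae_product hd; apply: filterS => h.
have mp D h : measurable D -> measurable (piece D h : set T) by exact: measurable_piece.
have fp D h : measurable D -> (mu D < +oo)%E -> (mu (piece D h) < +oo)%E.
  by move=> mD; apply: le_lt_trans; apply: le_measure; rewrite ?inE//; [exact: mp|move=> x []].
(* Integrating the two correlations over [y] gives products of measures, from which the common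
   finite positive measure of [E] and [F] cancels. *)
have pieceE h : good h -> mu (piece F h) = mu (piece E h).
  move=> gh.
  have : (mu (piece F h) * mu F = mu (piece E h) * mu E)%E.
    rewrite -!integral_correlation_cst//; try exact: mp.
    apply: ge0_ae_eq_integral => //; try (by apply: measurable_correlation => //; exact: mp).
    by move: gh; apply: filterS => y -> _.
  have f1 : mu (piece F h) \is a fin_num by rewrite ge0_fin_numE// fp.
  have f2 : mu (piece E h) \is a fin_num by rewrite ge0_fin_numE// fp.
  have f3 : mu E \is a fin_num by rewrite ge0_fin_numE.
  rewrite FE -(fineK f1) -(fineK f2) -(fineK f3) -!EFinM => -[] e.
  have ne : fine (mu E) != 0 by rewrite gt_eqF// fine_gt0// E0.
  by congr EFin; exact: (mulIf ne).
have gmatch h : good h -> 0 < h < delta -> exists M A B,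
    [/\ matched E F M A B, A `<=` piece E h, B `<=` piece F h,
      mu (piece E h `\` A) = 0 & mu (piece F h `\` B) = 0] /\ mu A = mu B /\
      mu A = mu (piece E h).
  move=> gh /andP[h0 hd'].
  have sE y : 0 < y < h -> mu (piece E h `&` translate E y) = mu (piece E h).
    by move=> yh; rewrite setIidl//; exact: gap.
  (* One lemma bounds both pieces: its hypothesis comes from the gaps for [E], and by transport
     through [good] for [F]. *)
  have [ME hME] : exists M : R, mu (piece E h `\` `[- M, M]%classic) = 0.
    by apply: piece_bounded => //; apply: aeW => y; exact: sE.
  have [MF hMF] : exists M : R, mu (piece F h `\` `[- M, M]%classic) = 0.
    apply: piece_bounded => //; move: (gh); apply: filterS => y e yh.
    by rewrite e sE// pieceE.
  pose M := Num.max ME MF; pose I : set T := `[- M, M]%classic.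
  have mI : measurable I by exact: measurable_itv.
  have sub D (M' : R) : measurable D -> M' <= M -> mu (D `\` `[- M', M']%classic) = 0 ->
      mu (D `\` I) = 0.
    move=> mD MM; apply: subset_measure0.
    - exact: measurableD.
    - by apply: measurableD => //; exact: measurable_itv.
    move=> x [Dx nI]; split => // xM; apply: nI; move: xM; rewrite /I/= !in_itv/= => /andP[l u].
    by rewrite (le_trans u MM) andbT (le_trans _ l)// lerN2.
  have nE : mu (piece E h `\` I) = 0.
    by apply: (sub _ ME) => //; [exact: mp|rewrite le_max lexx].
  have nF : mu (piece F h `\` I) = 0.
    by apply: (sub _ MF) => //; [exact: mp|rewrite le_max lexx orbT].
  have cutD D D' : measurable D -> measurable D' -> mu (D `\` I) = 0 ->
      mu (D `&` I `&` D') = mu (D `&` D').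
    move=> mD mD' n.
    have mDD : measurable (D `&` D') by exact: measurableI.
    rewrite (measureDI mu mDD mI) [X in (X + _)%E](_ : _ = 0); last first.
      apply: subset_measure0 n; [exact: measurableD|exact: measurableD|].
      by move=> x [[]].
    by rewrite add0e; congr (mu _); rewrite setIAC.
  have cut D : measurable D -> mu (D `\` I) = 0 -> mu (D `&` I) = mu D.
    by move=> mD n; have := cutD D setT mD measurableT n; rewrite !setIT.
  exists M, (piece E h `&` I), (piece F h `&` I); split; last first.
    by rewrite !cut//; try exact: mp; rewrite pieceE.
  have mpE := mp E h mE; have mpF := mp F h mF.
  have diffI D : mu (D `\` I) = 0 -> mu (D `\` (D `&` I)) = 0.
    by rewrite setDIr setDv set0U.
  split; [split|by move=> x []|by move=> x []|exact: diffI|exact: diffI].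
  - exact: measurableI.
  - exact: measurableI.
  - by move=> x [].
  - by move=> x [].
  move: gh; apply: filterS => y e.
  rewrite (cutD (piece E h))//; last exact: measurable_translate.
  by rewrite (cutD (piece F h))//; exact: measurable_translate.
(* Good shifts have full measure, so every nonempty open interval contains one. *)
have hseq (n : nat) : exists h : R, 0 < h < Num.min delta n.+1%:R^-1 /\ good h.
  have [|h h1 h2] := @ae_exists_itv R good 0 (Num.min delta n.+1%:R^-1) _ hgood.
    by rewrite lt_min d0 invr_gt0/=.
  by exists h.
pose h n := projT1 (cid (hseq n)).
have hP n : 0 < h n < Num.min delta n.+1%:R^-1 /\ good (h n).
  by rewrite /h; case: cid.
have h0 n : 0 < h n by have [/andP[]] := hP n.
have hdl n : 0 < h n < delta.
  by have [/andP[a]] := hP n; rewrite lt_min a => /andP[].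
have hcv : h n @[n --> \oo] --> 0.
  apply: (@squeeze_cvgr _ _ _ _ (cst 0) harmonic); last exact: cvg_harmonic.
    apply: nearW => n; rewrite (ltW (h0 n))/=.
    by have [/andP[_]] := hP n; rewrite lt_min => /andP[_ /ltW].
  exact: cvg_cst.
have cvE := piece_cvg oE fE h0 hcv.
have small (e : R) : 0 < e -> exists n, (mu (E `\` piece E (h n)) < e%:E)%E.
  move=> e0; have /fine_cvgP[fn cv] := cvE.
  move/cvgrPdist_lt : cv => /(_ e e0) cv.
  have [n _ hn] : (\forall n \near \oo, mu (E `\` piece E (h n)) \is a fin_num /\
     (`|0 - fine (mu (E `\` piece E (h n)))| < e)%R) by near=> n; split; near: n.
  exists n; have [fin lt] := hn n (leqnn n).
  rewrite -(fineK fin) lte_fin; move: lt; rewrite sub0r normrN.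
  by apply: le_lt_trans; exact: ler_norm.
have splitE D k : measurable D -> mu D = (mu (D `\` piece D k) + mu (piece D k))%E.
  move=> mD; rewrite [LHS](measureDI mu mD (mp D k mD)); congr (_ + mu _)%E.
  by rewrite setIidr// => x [].
have diffFE k : good k -> mu (F `\` piece F k) = mu (E `\` piece E k).
  move=> gk; have := splitE F k mF; rewrite FE (splitE E k mE) pieceE//.
  have f2 : mu (piece E k) \is a fin_num by rewrite ge0_fin_numE// fp.
  by move=> e; rewrite -[LHS](addeK _ f2) -e addeK.
(* A reference piece of positive measure, which makes its Laplace transforms positive; it fixes [a]
   once and for all. *)
have [n0 hn0] := small _ (fine_gt0 (introT andP (conj E0 fE))).
have fEn : mu E \is a fin_num by rewrite ge0_fin_numE.
have posE n : (mu (E `\` piece E (h n)) < mu E)%E -> (0 < mu (piece E (h n)))%E.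
  move=> lt; rewrite lt0e measure_ge0 andbT; apply/negP => /eqP e.
  by move: lt; rewrite [X in (_ < X)%E](splitE E (h n) mE) e adde0 ltxx.
rewrite fineK// in hn0.
have [M0 [A0 [B0 [[m0 _ _ _ _] [AB0 A0E]]]]] := gmatch _ (hP n0).2 (hdl n0).
have A0pos : (0 < mu A0)%E by rewrite A0E posE.
have B0pos : (0 < mu B0)%E by rewrite -AB0.
pose w := laplace A0 1 / laplace B0 1.
have w0 : 0 < w.
  have [mA mB AM BM _] := m0.
  by rewrite divr_gt0// ?(laplace_gt0 1 mA AM)// (laplace_gt0 1 mB BM).
pose a := ln w.
have aw : expR a = w by rewrite lnK// posrE.
exists a.
have mTa : measurable (translate E a : set T) by exact: measurable_translate.
have tri (X Y Z : set T) : measurable X -> measurable Y -> measurable Z ->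
    mu Y = 0 -> mu Z = 0 -> (mu (X `|` Y `|` Z) <= mu X)%E.
  move=> mX mY mZ Y0 Z0.
  apply: (le_trans (measureU2 mu (measurableU _ _ mX mY) mZ)); rewrite [X in (_ + X)%E]Z0 adde0.
  by apply: (le_trans (measureU2 mu mX mY)); rewrite [X in (_ + X)%E]Y0 adde0.
(* On the pieces, [F] and the translate of [E] agree up to null sets, so they differ only by what
   the pieces leave out, and this has the same measure in [E] and in [F]. *)
have key n : (mu (E `\` piece E (h n)) < mu E)%E ->
    (mu (F `\` translate E a) <= mu (E `\` piece E (h n)))%E /\
    (mu (translate E a `\` F) <= mu (E `\` piece E (h n)))%E.
  move=> lt; have gn := (hP n).2.
  have [M [A [B [[m1 AE BF nA nB] [AB AEe]]]]] := gmatch _ gn (hdl n).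
  have Apos : (0 < mu A)%E by rewrite AEe posE.
  have lr := laplace_ratio mE mF fE fF E0 hd m0 A0pos AB0 m1 Apos AB.
  have [t1 t2] := matched_translate m1 aw lr.
  have [mA mB _ _ _] := m1.
  have mEh := mp E (h n) mE; have mFh := mp F (h n) mF.
  have mTA : measurable (translate A a : set T) by exact: measurable_translate.
  have BA : mu (B `\` translate A a) = 0.
    rewrite -(@lebesgue_measure_translate R _ (- a)); last exact: measurableD.
    rewrite -t2; congr (mu _); rewrite !translateE; apply/seteqP.
    by split => x /=; rewrite subrK.
  have AB' : mu (translate A a `\` B) = 0.
    rewrite -(@lebesgue_measure_translate R _ (- a)); last exact: measurableD.
    rewrite -t1; congr (mu _); rewrite !translateE; apply/seteqP.
    by split => x /=; rewrite subrK.
  split.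
    rewrite -(diffFE _ gn).
    apply: (le_trans _ (@tri _ (piece F (h n) `\` B) (B `\` translate A a) _ _ _ nB BA));
      try exact: measurableD.
    apply: le_measure; rewrite ?inE; first exact: measurableD.
      by apply: measurableU; [apply: measurableU|]; exact: measurableD.
    (* A point of the difference is lost when passing from [F] to its piece, from the piece to [B],
       or from [B] to the translate of [A]; the last two losses are null. *)
    move=> x [Fx nTE].
    have [Fh|nFh] := pselect (piece F (h n) x); last by left; left.
    have [Bx|nB'] := pselect (B x); last by left; right.
    right; split => // TA; apply: nTE; move: TA; rewrite !translateE/= => /AE.
    by case.
  have nTA : mu (translate (piece E (h n) `\` A) a) = 0.
    by rewrite lebesgue_measure_translate//; exact: measurableD.
  rewrite -(@lebesgue_measure_translate R (E `\` piece E (h n)) a); last exact: measurableD.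
  apply: (le_trans _ (@tri _ (translate (piece E (h n) `\` A) a)
    (translate A a `\` B) _ _ _ nTA AB'));
    try (by apply: measurable_translate; exact: measurableD); try exact: measurableD.
  apply: le_measure; rewrite ?inE; first exact: measurableD.
    apply: measurableU; [apply: measurableU|exact: measurableD];
    by apply: measurable_translate; exact: measurableD.
  rewrite !translateE => x /= [Ex nF].
  have [Eh|nEh] := pselect (piece E (h n) (x + a)); last by left; left.
  have [Ax|nA'] := pselect (A (x + a)); last by left; right.
  by right; split => // /BF[].
have zero (X : set T) : (forall n, (mu (E `\` piece E (h n)) < mu E)%E ->
    (mu X <= mu (E `\` piece E (h n)))%E) -> mu X = 0.
  move=> hX; apply/eqP; rewrite eq_le measure_ge0 andbT.
  apply/lee_addgt0Pr => e e0; rewrite add0e.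
  have [|n hn] := small (Num.min e (fine (mu E))).
    by rewrite lt_min e0/= fine_gt0// E0 fE.
  have lt : (mu (E `\` piece E (h n)) < mu E)%E.
    by rewrite (lt_le_trans hn)// -[leRHS](fineK fEn) lee_fin ge_min lexx orbT.
  apply: (le_trans (hX n lt)); apply: (le_trans (ltW hn)).
  by rewrite lee_fin ge_min lexx.
have z1 := zero _ (fun n lt => (key n lt).1).
have z2 := zero _ (fun n lt => (key n lt).2).
rewrite setY_def.
apply/eqP; rewrite eq_le measure_ge0 andbT.
apply: (le_trans (measureU2 mu _ _)); try exact: measurableD.
by rewrite [X in (X + _)%E]z1 [X in (_ + X)%E]z2 adde0.
Unshelve. all: by end_near. Qed.

End core.

(** * The gap condition, and the passage from Lebesgue to Borel measurable sets *)

Section reduction.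
Context {R : realType}.
Local Notation mu := (@lebesgue_measure R).
Local Notation T := (measurableTypeR R).

(** Two points of [E] less than [delta] apart cannot be separated by a gap; they share a component,
    which then contains every point between them. *)
Lemma lower_bounded_gaps_piece (E : set R) : open_lower_bounded_gaps E ->
  [/\ open E, (0 < mu E)%E & exists2 delta : R, 0 < delta &
    forall y h, 0 < y < h -> h < delta -> piece E h `<=` translate E y].
Proof.
move=> [alpha [beta [ab ba]]].
set delta := inf _ => d0 EE.
have dP k : delta <= alpha (k + 1) - beta k.
  apply: ge_inf; last by exists k.
  by exists 0 => _ [j _ <-]; rewrite subr_ge0 ltW.
have alphaS k : alpha k <= alpha (k + 1) by rewrite ltW// (lt_trans (ab k)).
have alphaD k (n : nat) : alpha k <= alpha (k + n%:Z).
  elim: n => [|n ih]; first by rewrite addr0.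
  by rewrite -addn1 PoszD addrA (le_trans ih).
have far j k : (j < k)%R -> beta j + delta <= alpha k.
  move=> jk; have : beta j + delta <= alpha (j + 1) by rewrite -lerBrDl.
  move=> /le_trans; apply.
  have -> : k = (j + 1) + (absz (k - (j + 1))%R)%:Z.
    by rewrite abszE ger0_norm ?subr_ge0 ?lezD1// addrC subrK.
  exact: alphaD.
have oE : open E.
  by rewrite EE; apply: bigcup_open => k _; exact: interval_open.
split => //.
  apply: (@lt_le_trans _ _ (mu `]alpha 0, beta 0[%classic)).
    by rewrite lebesgue_measure_itv/= lte_fin ab -EFinB lte_fin subr_gt0.
  apply: le_measure; rewrite ?inE; first exact: measurable_itv.
    exact: open_measurable.
  by move=> x xI; rewrite EE; exists 0.
exists delta => // y h /andP[y0 yh] hd x [].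
rewrite !translateE /= EE => -[j _ /=]; rewrite in_itv/= => /andP[j1 j2].
move=> [k _ /=]; rewrite in_itv/= => /andP[k1 k2].
have [jk|kj|jk] := ltgtP j k.
- by have := far _ _ jk; lra.
- by have := far _ _ kj; lra.
by subst k; exists j => //=; rewrite in_itv/=; apply/andP; split; lra.
Qed.

(* [lebesgue_measure] is, on all sets, the outer measure that also defines
   [completed_lebesgue_measure]; the two are convertible. *)
Lemma outer_lebesgue_le (A B : set R) : A `<=` B -> (mu A <= mu B)%E.
Proof. exact: (@le_outer_measure _ _ (wlength (@idfun R))^*%mu). Qed.

Lemma outer_lebesgueU_null (A Z : set R) : mu Z = 0 -> (mu (A `|` Z) <= mu A)%E.
Proof.
move=> Z0; apply: (le_trans (@outer_measureU2 _ _ (wlength (@idfun R))^*%mu A Z)).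
by rewrite [X in (_ + X)%E]Z0 adde0.
Qed.

(** The Caratheodory measurable sets form the completion of the Borel sets: each is a Borel set
    joined with a subset of a null Borel set. *)
Lemma lebesgue_measurable_borel (F : set R) : lebesgue_measurable F ->
  exists A Z : set T, [/\ measurable A, measurable Z, mu Z = 0, A `<=` F & F `<=` A `|` Z].
Proof.
rewrite /lebesgue_measurable -completed_caratheodory_measurable.
rewrite g_sigma_completed_algebra_genE => -[A mA [N [Z [mZ Z0 NZ]]] <-].
by exists A, Z; split => //; exact: setUS.
Qed.

(** The intersection for [F] exceeds the one for [A] by points of [Z] or of its two translates.
    Monotonicity and subadditivity of the outer measure give equality at every [w], even where the
    sets are not Borel. *)
Lemma three_deck_null (A Z : set T) (F : set R) (w : R * R) : measurable Z -> mu Z = 0 ->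
  A `<=` F -> F `<=` A `|` Z -> three_deck F w = deck A w.
Proof.
move=> mZ Z0 AF FAZ.
have trZ x : mu (translate Z x) = 0 by rewrite lebesgue_measure_translate.
apply/eqP; rewrite eq_le; apply/andP; split; last first.
  apply: outer_lebesgue_le; rewrite !translateE => x [[a1 a2] a3].
  by split; [split|]; exact: AF.
have u3 := outer_lebesgueU_null
  (A `&` translate A w.1 `&` translate A w.2 `|` Z `|` translate Z w.1) (trZ w.2).
have u2 := outer_lebesgueU_null (A `&` translate A w.1 `&` translate A w.2 `|` Z) (trZ w.1).
have u1 := outer_lebesgueU_null (A `&` translate A w.1 `&` translate A w.2) Z0.
apply: le_trans (le_trans u3 (le_trans u2 u1)).
apply: outer_lebesgue_le; rewrite !translateE => x /= [[/FAZ f1 /FAZ f2] /FAZ f3].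
case: f1 => [a1|z1]; last by left; left; right.
case: f2 => [a2|z2]; last by left; right.
case: f3 => [a3|z3]; last by right.
by left; left; left.
Qed.

End reduction.

Theorem theorem2p9 (R : realType) (E F : set R)
    (hE : open_lower_bounded_gaps E)
    (hEfin : (completed_lebesgue_measure E < +oo)%E)
    (hF : lebesgue_measurable F)
    (hdeck : {ae (@lebesgue_measure R \x @lebesgue_measure R)%E,
                forall x : R * R, three_deck F x = three_deck E x}) :
  exists a : R, completed_lebesgue_measure (F `+` translate E a) = 0%E.
Proof.
have [oE E0 [delta d0 gap]] := lower_bounded_gaps_piece hE.
have [A [Z [mA mZ Z0 AF FAZ]]] := lebesgue_measurable_borel hF.
have hd : {ae sfprod (@lebesgue_measure R) (@lebesgue_measure R),
    forall w, deck A w = deck E w}.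
  have : {ae sfprod (@lebesgue_measure R) (@lebesgue_measure R),
    forall w : measurableTypeR R * measurableTypeR R, three_deck F w = three_deck E w} := hdeck.
  by apply: filterS => w; rewrite (three_deck_null w mZ Z0 AF FAZ) => ->.
have [a ha] := translate_of_deck oE mA hEfin E0 d0 gap hd.
exists a; apply/eqP; rewrite eq_le; apply/andP; split; last first.
  exact: (measure_ge0 (@lebesgue_measure R)).
rewrite -[X in (_ <= X)%E]ha; apply: le_trans (outer_lebesgueU_null _ Z0).
(* Replacing [A] by [F] changes the symmetric difference by points of [Z] only. *)
apply: outer_lebesgue_le; rewrite !setY_def => x.
move=> [[/FAZ[Ax|Zx] nE]|[Ex nF]]; [by left; left|by right|].
by left; right; split => // /AF.
Qed.
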